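(* Graph Isomorphism is GI-complete on $(\mathrm{diamond},P_6)$-free graphs.
   Context: Graph Isomorphism is the problem of deciding, given two graphs $G$ and $H$, whether there is an isomorphism from $G$ to $H$; a problem is GI-complete if it is polynomial-time equivalent to Graph Isomorphism. A graph is $(H_1,H_2)$-free if it contains no induced subgraph isomorphic to $H_1$ or $H_2$. The diamond is $\overline{2P_1+P_2}$ (i.e. $K_4$ minus an edge); $P_r$ denotes the path on $r$ vertices. *)

(* Defs.v *)
From mathcomp Require Import all_boot.
Set Implicit Arguments. Unset Strict Implicit. Unset Printing Implicit Defensive.

Definition simple_graph (n : nat) (E : rel 'I_n) : Prop :=
  (forall i, ~~ E i i) /\ (forall i j, E i j = E j i).

Definition isomorphic (n m : nat) (E : rel 'I_n) (F : rel 'I_m) : Prop :=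
  exists f : 'I_n -> 'I_m, bijective f /\ forall i j, E i j = F (f i) (f j).

Definition induced_sub (k n : nat) (H : rel 'I_k) (E : rel 'I_n) : Prop :=
  exists f : 'I_k -> 'I_n, injective f /\ forall i j, H i j = E (f i) (f j).

Definition diamond : rel 'I_4 := fun i j =>
  (i != j) && ~~ (((val i == 0) && (val j == 1)) || ((val i == 1) && (val j == 0))).

Definition path_graph (r : nat) : rel 'I_r := fun i j =>
  ((val i).+1 == val j) || ((val j).+1 == val i).

Arguments path_graph r : clear implicits.

Definition diamond_P6_free (n : nat) (E : rel 'I_n) : Prop :=
  ~ induced_sub diamond E /\ ~ induced_sub (path_graph 6) E.

Inductive sym := S0 | S1 | Sep.

Definition code (n : nat) (E : rel 'I_n) : seq sym :=
  flatten [seq [seq (if E i j then S1 else S0) | j <- enum 'I_n] | i <- enum 'I_n].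

(* Promise problems: (domain of valid instances, yes-instances). *)
Record problem := Problem { dom : seq sym -> Prop; yes : seq sym -> Prop }.

Definition GI : problem := Problem
  (fun w => exists n m (E : rel 'I_n) (F : rel 'I_m),
      simple_graph E /\ simple_graph F /\ w = code E ++ Sep :: code F)
  (fun w => exists n m (E : rel 'I_n) (F : rel 'I_m),
      simple_graph E /\ simple_graph F /\ w = code E ++ Sep :: code F
      /\ isomorphic E F).

Definition GI_diamond_P6 : problem := Problem
  (fun w => exists n m (E : rel 'I_n) (F : rel 'I_m),
      simple_graph E /\ simple_graph F /\ diamond_P6_free E /\ diamond_P6_free F
      /\ w = code E ++ Sep :: code F)
  (fun w => exists n m (E : rel 'I_n) (F : rel 'I_m),
      simple_graph E /\ simple_graph F /\ diamond_P6_free E /\ diamond_P6_free F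
      /\ w = code E ++ Sep :: code F /\ isomorphic E F).

(* Tape alphabet 'I_(tm_G.+4): 0 = blank, 1 = S0, 2 = S1, 3 = Sep, others work
   symbols.  States 'I_(tm_Q.+1), start state 0.  Two-way infinite tape. *)
Inductive move := MoveL | MoveR | Stay.

Record TM := mkTM {
  tm_Q : nat;
  tm_G : nat;
  tm_delta : 'I_tm_Q.+1 -> 'I_tm_G.+4 -> 'I_tm_Q.+1 * 'I_tm_G.+4 * move;
  tm_halt : 'I_tm_Q.+1 -> bool }.

Arguments tm_delta : clear implicits.
Arguments tm_halt : clear implicits.

(* configuration: state, cells left of head (nearest first), cells from head on *)
Definition config (M : TM) : Type :=
  ('I_(tm_Q M).+1 * seq 'I_(tm_G M).+4 * seq 'I_(tm_G M).+4)%type.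

Definition sym_code (G : nat) (s : sym) : 'I_G.+4 :=
  match s with S0 => inord 1 | S1 => inord 2 | Sep => inord 3 end.

Definition code_sym (G : nat) (a : 'I_G.+4) : option sym :=
  match val a with 1 => Some S0 | 2 => Some S1 | 3 => Some Sep | _ => None end.

Definition tm_step (M : TM) (c : config M) : config M :=
  let: (q, l, r) := c in
  if tm_halt M q then c else
  let a := head ord0 r in
  let: (q', b, mv) := tm_delta M q a in
  let r' := b :: behead r in
  match mv with
  | Stay => (q', l, r')
  | MoveR => (q', b :: l, behead r)
  | MoveL => match l with
             | [::] => (q', [::], ord0 :: r')
             | x :: l' => (q', l', x :: r')
             end
  end.

Definition tm_init (M : TM) (w : seq sym) : config M :=
  (ord0, [::], map (@sym_code (tm_G M)) w).

(* Output: the maximal prefix, starting at the head, of input-alphabet symbols. *)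
Fixpoint read_out (G : nat) (s : seq 'I_G.+4) : seq sym :=
  match s with
  | [::] => [::]
  | a :: s' => match code_sym a with Some x => x :: read_out s' | None => [::] end
  end.

(* M on input w halts after exactly k steps (i.e. within k steps) with output out *)
Definition tm_computes_in (M : TM) (w : seq sym) (k : nat) (out : seq sym) : Prop :=
  let c := iter k (@tm_step M) (tm_init M w) in
  tm_halt M c.1.1 /\ read_out c.2 = out.

Definition poly_time (f : seq sym -> seq sym) : Prop :=
  exists (M : TM) (d : nat), forall w,
    exists k, k <= (size w) ^ d + d /\ tm_computes_in M w k (f w).

Definition poly_reduces (P1 P2 : problem) : Prop :=
  exists f, poly_time f /\
    forall w, dom P1 w -> dom P2 (f w) /\ (yes P1 w <-> yes P2 (f w)).

Definition poly_equivalent (P1 P2 : problem) : Prop :=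
  poly_reduces P1 P2 /\ poly_reduces P2 P1.

Definition GI_complete (P : problem) : Prop := poly_equivalent P GI.

(* Main.v *)
From HB Require Import structures.
Require Import Defs.
From mathcomp Require Import all_boot zify.
Set Implicit Arguments. Unset Strict Implicit. Unset Printing Implicit Defensive.

(** A graph G is mapped to a graph H(G) on the vertices of G, the arcs (i, j) with
    i <> j, and two flags for every arc between adjacent vertices.  Vertices and
    arcs form a complete bipartite graph, and the two flags of an arc (i, j) are
    adjacent to that arc and, respectively, to i and to j; every vertex also gets
    pendant flags.  Flags are independent and see at most one vertex and at most one
    arc, so every edge of H(G) lies in at most one triangle, and no assignment of the
    three kinds to the vertices of an induced P6 is possible.  Vertices are
    recognised in H(G) by their pendant neighbours, and i, j are adjacent in G iff
    some triangles through i and through j share a further vertex.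

    The map is computed by a loop program whose counters range over the positions of
    the input.  Such a program runs in polynomial time by its shape alone, and a
    Turing machine executes it by keeping the counters as marks on the cells of
    the input and writing the output behind the input. *)

(** * Loop programs and the machine *)

Lemma iter_inv (T : Type) (P : T -> Prop) (f : T -> T) n x :
  (forall y, P y -> P (f y)) -> P x -> P (iter n f x).
Proof. by move=> Pf Px; elim: n => //= n; apply: Pf. Qed.

Lemma inord5_eq (m k : nat) : m < 5 -> k < 5 -> (inord m == inord k :> 'I_5) = (m == k).
Proof. by move=> m5 k5; rewrite -val_eqE /= !inordK. Qed.

Section LoopLanguage.
Variable K : nat.
Local Notation var := 'I_K.

Inductive test := TLt of var & var | TEq of var & var | TSym of var & 'I_5.

Inductive prog :=
  | Skip
  | Inc of var
  | Zero of var
  | Out of sym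
  | Seq of prog & prog
  | If of test & prog & prog
  | For of var & prog.

Definition store := {ffun var -> nat}.

Definition upd (s : store) (x : var) (v : nat) : store :=
  [ffun y => if y == x then v else s y].

Definition sym_index (a : sym) : 'I_5 :=
  match a with S0 => inord 0 | S1 => inord 1 | Sep => inord 2 end.
Definition end1 : 'I_5 := inord 3.
Definition end2 : 'I_5 := inord 4.

(** Counters saturate at this value. It exceeds the input length by one, so an overflowing sum is
    never mistaken for the position [size w], and it is the position carrying [end2]. *)
Definition max_index (w : seq sym) : nat := (size w).+1.

Definition sym_at (w : seq sym) (j : nat) : 'I_5 :=
  nth end2 (rcons (map sym_index w) end1) j.

Definition teval (w : seq sym) (s : store) (t : test) : bool :=
  match t with
  | TLt x y => s x < s y
  | TEq x y => s x == s y
  | TSym x a => sym_at w (s x) == a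
  end.

Definition inc (w : seq sym) (s : store) (x : var) : store :=
  upd s x (minn (s x).+1 (max_index w)).

(* [For x p] runs [p] with [x] = 0, 1, ..., |w| + 1. *)
Fixpoint run (w : seq sym) (p : prog) (s : store) : store * seq sym :=
  match p with
  | Skip => (s, [::])
  | Inc x => (inc w s x, [::])
  | Zero x => (upd s x 0, [::])
  | Out a => (s, [:: a])
  | Seq p q => let r1 := run w p s in let r2 := run w q r1.1 in (r2.1, r1.2 ++ r2.2)
  | If t p q => if teval w s t then run w p s else run w q s
  | For x p =>
      iter (max_index w).+1
        (fun so => let r := run w p so.1 in (inc w r.1 x, so.2 ++ r.2)) (upd s x 0, [::])
  end.

Fixpoint writes (p : prog) : seq var :=
  match p with
  | Inc x | Zero x => [:: x]
  | Seq p q | If _ p q => writes p ++ writes q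
  | For x p => x :: writes p
  | _ => [::]
  end.

(** Keeping the loop variable out of the body makes its value count the iterations, so compiled
    loops can decide termination from that value. *)
Fixpoint wf (p : prog) : bool :=
  match p with
  | Seq p q | If _ p q => wf p && wf q
  | For x p => (x \notin writes p) && wf p
  | _ => true
  end.

(** Bounds both the number of executed instructions and the output length. Each loop iteration pays
    two extra instructions, the exit test and the increment; the last unit pays for resetting the
    loop variable. *)
Fixpoint cost (p : prog) (M : nat) : nat :=
  match p with
  | Seq p q | If _ p q => (cost p M + cost q M).+1
  | For _ p => (M.+1 * (cost p M).+2).+1
  | _ => 1
  end.

Definition zero_store : store := [ffun=> 0].

Definition transduce (p : prog) (w : seq sym) : seq sym := (run w p zero_store).2.

Section Semantics.
Variable w : seq sym.
Local Notation M := (max_index w).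

Definition bounded (s : store) := forall x, s x <= M.

Lemma updE s x v y : upd s x v y = if y == x then v else s y.
Proof. by rewrite ffunE. Qed.

Lemma upd_same s x v : upd s x v x = v.
Proof. by rewrite updE eqxx. Qed.

Lemma upd_id s x : upd s x (s x) = s.
Proof. by apply/ffunP => y; rewrite updE; case: eqP => // ->. Qed.

Lemma bounded_upd s x v : bounded s -> v <= M -> bounded (upd s x v).
Proof. by move=> bs vM y; rewrite updE; case: ifP. Qed.

Lemma bounded_inc s x : bounded s -> bounded (inc w s x).
Proof. by move=> bs; apply: bounded_upd => //; rewrite geq_minr. Qed.

Definition loop_body (p : prog) (x : var) (so : store * seq sym) : store * seq sym :=
  let r := run w p so.1 in (inc w r.1 x, so.2 ++ r.2).

Lemma run_For x p s : run w (For x p) s = iter M.+1 (loop_body p x) (upd s x 0, [::]).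
Proof. by []. Qed.

Lemma run_bounded p s : bounded s -> bounded (run w p s).1.
Proof.
elim: p s => [|x|x|a|p IHp q IHq|t p IHp q IHq|x p IHp] s bs.
- by [].
- exact: bounded_inc.
- exact: bounded_upd.
- by [].
- exact/IHq/IHp.
- by rewrite /=; case: ifP => _; [exact: IHp | exact: IHq].
- rewrite run_For; refine (iter_inv (P := fun so => bounded so.1) _ _ _) => [so bso|].
    exact/bounded_inc/IHp.
  exact: bounded_upd.
Qed.

Lemma run_frame p s x : x \notin writes p -> (run w p s).1 x = s x.
Proof.
elim: p s => [|y|y|a|p IHp q IHq|t p IHp q IHq|y p IHp] s //.
- by rewrite inE => /negPf nxy; rewrite /= /inc updE nxy.
- by rewrite inE => /negPf nxy; rewrite /= updE nxy.
- by rewrite mem_cat negb_or => /andP[xp xq]; rewrite /= IHq // IHp.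
- by rewrite mem_cat negb_or => /andP[xp xq] /=; case: ifP => _; rewrite ?IHq ?IHp.
- rewrite run_For [writes _]/= inE negb_or => /andP[/negPf nxy xp].
  refine (iter_inv (P := fun so : store * seq sym => so.1 x = s x) _ _ _) => [so <-|].
    by rewrite /= /inc updE nxy IHp.
  by rewrite updE nxy.
Qed.

(** The output lies on the tape behind the input, so its length enters the time of a single
    instruction. *)
Lemma size_run p s : size (run w p s).2 <= cost p M.
Proof.
elim: p s => [|y|y|a|p IHp q IHq|t p IHp q IHq|y p IHp] s //.
- by rewrite /= size_cat; have := IHp s; have := IHq (run w p s).1; lia.
- by rewrite /=; case: ifP => _; have := IHp s; have := IHq s; lia.
- rewrite run_For [cost _ _]/=; set so := (upd _ _ _, _).
  suff H k : size (iter k (loop_body p y) so).2 <= k * cost p M by have := H M.+1; lia.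
  elim: k => [|k IHk] //=; rewrite size_cat mulSn addnC; exact: leq_add.
Qed.

End Semantics.

(** * The Turing machine that executes compiled programs *)

Inductive phase := PStart | PInit | PEnd | PFind | PPut | PBack | PRewind | PSet | PDone.

Definition phase_rank (p : phase) : 'I_9 :=
  inord match p with
    | PStart => 0 | PInit => 1 | PEnd => 2 | PFind => 3 | PPut => 4
    | PBack => 5 | PRewind => 6 | PSet => 7 | PDone => 8 end.

Definition phase_of_rank (i : 'I_9) : phase :=
  nth PDone [:: PStart; PInit; PEnd; PFind; PPut; PBack; PRewind; PSet] i.

Lemma phase_rankK : cancel phase_rank phase_of_rank.
Proof. by case; rewrite /phase_of_rank /phase_rank inordK. Qed.

HB.instance Definition _ := Finite.copy phase (can_type phase_rankK).

Inductive instr :=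
  | IHalt
  | INop of nat
  | IInc of var & nat
  | IZero of var & nat
  | IOut of sym & nat
  | IIf of test & nat & nat.

(** A cell holds an input symbol and the set of counters whose current value is its position.
    Besides cells, the tape holds blanks ([None]) and plain symbols: unread input or output. *)
Definition cell : finType := ('I_5 * {set var})%type.
Definition tsym := option (sym + cell).

Definition mark (x : var) (c : cell) : tsym := Some (inr (c.1, x |: c.2)).
Definition unmark (x : var) (c : cell) : tsym := Some (inr (c.1, c.2 :\ x)).

(* The scan from the left stops at the first cell carrying one of the tested
   marks, where the outcome is known. *)
Definition decide (t : test) (c : cell) : option bool :=
  match t with
  | TLt x y => if x \in c.2 then Some (y \notin c.2)
               else if y \in c.2 then Some false else None
  | TEq x y => if x \in c.2 then Some (y \in c.2)
               else if y \in c.2 then Some false else None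
  | TSym x a => if x \in c.2 then Some (c.1 == a) else None
  end.

Section Machine.
Variable prg : seq instr.

Definition mstate : finType := (phase * 'I_(size prg).+1)%type.

(** [PStart], [PInit] and [PEnd] turn the input into cells with all counters at 0. [PFind] scans
    right to the cell where the instruction acts. [PPut] and [PSet] drop a moved mark on the next
    cell and on the first cell. [PBack] and [PRewind] return to the left end, before the next
    instruction and before [PSet]. *)
Definition delta (q : mstate) (a : tsym) : mstate * tsym * move :=
  let: (ph, pc) := q in
  match ph with
  | PStart =>
      if a is Some (inl s) then ((PInit, pc), Some (inr (sym_index s, setT)), MoveR)
      else ((PEnd, pc), Some (inr (end1, setT)), MoveR)
  | PInit =>
      if a is Some (inl s) then ((PInit, pc), Some (inr (sym_index s, set0)), MoveR)
      else ((PEnd, pc), Some (inr (end1, set0)), MoveR)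
  | PEnd => ((PBack, pc), Some (inr (end2, set0)), Stay)
  | PBack => if a is None then ((PFind, pc), a, MoveR) else (q, a, MoveL)
  | PRewind => if a is None then ((PSet, pc), a, MoveR) else (q, a, MoveL)
  | PFind =>
      match nth IHalt prg pc, a with
      | INop k, _ => ((PFind, inord k), a, Stay)
      | IInc x k, Some (inr c) =>
          if x \in c.2 then
            if c.1 == end2 then ((PBack, inord k), a, Stay)
            else ((PPut, pc), unmark x c, MoveR)
          else (q, a, MoveR)
      | IZero x k, Some (inr c) =>
          if x \in c.2 then ((PRewind, pc), unmark x c, Stay) else (q, a, MoveR)
      | IOut s k, None => ((PBack, inord k), Some (inl s), Stay)
      | IIf t k1 k2, Some (inr c) =>
          if decide t c is Some b then ((PBack, inord (if b then k1 else k2)), a, Stay)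
          else (q, a, MoveR)
      | IHalt, Some (inr c) =>
          if c.1 == end2 then ((PDone, pc), a, MoveR) else (q, a, MoveR)
      | _, _ => (q, a, MoveR)
      end
  | PPut =>
      match nth IHalt prg pc, a with
      | IInc x k, Some (inr c) => ((PBack, inord k), mark x c, Stay)
      | _, _ => (q, a, Stay)
      end
  | PSet =>
      match nth IHalt prg pc, a with
      | IZero x k, Some (inr c) => ((PFind, inord k), mark x c, Stay)
      | _, _ => (q, a, Stay)
      end
  | PDone => (q, a, Stay)
  end.

Definition halted (q : mstate) : bool := if q.1 is PDone then true else false.

Definition mconfig := (mstate * seq tsym * seq tsym)%type.

Definition mstep (c : mconfig) : mconfig :=
  let: (q, l, r) := c in
  if halted q then c else
  let: (q', b, mv) := delta q (head None r) in
  match mv with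
  | Stay => (q', l, b :: behead r)
  | MoveR => (q', b :: l, behead r)
  | MoveL => match l with
             | [::] => (q', [::], None :: b :: behead r)
             | x :: l' => (q', l', x :: b :: behead r)
             end
  end.

(** * Encoding the machine as a [TM] *)

Definition mstart : mstate := (PStart, ord0).

(** The blank and the three input symbols have prescribed codes below 4; the cells are numbered
    behind them. *)
Definition tsym_ord (a : tsym) : 'I_(#|cell|).+4 :=
  match a with
  | None => ord0
  | Some (inl s) => @sym_code #|cell| s
  | Some (inr c) => @rshift 4 #|cell| (enum_rank c)
  end.

Definition ord_tsym (a : 'I_(#|cell|).+4) : tsym :=
  match @split 4 #|cell| a with
  | inr i => Some (inr (enum_val i))
  | inl _ => omap inl (code_sym a)
  end.

Lemma code_sym_sym_code G s : code_sym (@sym_code G s) = Some s.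
Proof. by case: s; rewrite /code_sym /= inordK. Qed.

Lemma tsym_ordK : cancel tsym_ord ord_tsym.
Proof.
have small (a : 'I_(#|cell|).+4) : a < 4 -> ord_tsym a = omap inl (code_sym a).
  by rewrite /ord_tsym; case: (@splitP 4 #|cell| a) => // k -> /=; lia.
case=> [[s|c]|] /=.
- by rewrite small ?code_sym_sym_code //; case: s; rewrite /= inordK.
- by rewrite /ord_tsym (unsplitK (inr _)) enum_rankK.
- by rewrite small.
Qed.

(* The initial state of a [TM] must be [ord0], which therefore is a second code
   of [mstart]. *)
Definition mstate_ord (q : mstate) : 'I_(#|mstate|).+1 := lift ord0 (enum_rank q).
Definition ord_mstate (i : 'I_(#|mstate|).+1) : mstate :=
  if unlift ord0 i is Some j then enum_val j else mstart.

Lemma mstate_ordK : cancel mstate_ord ord_mstate.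
Proof. by move=> q; rewrite /ord_mstate /mstate_ord liftK enum_rankK. Qed.

Lemma ord_mstate0 : ord_mstate ord0 = mstart.
Proof. by rewrite /ord_mstate unlift_none. Qed.

Definition machine : TM :=
  @mkTM #|mstate| #|cell|
    (fun i a => let: (q, b, mv) := delta (ord_mstate i) (ord_tsym a) in
                (mstate_ord q, tsym_ord b, mv))
    (fun i => halted (ord_mstate i)).

Definition encode (c : mconfig) : config machine :=
  (mstate_ord c.1.1, map tsym_ord c.1.2, map tsym_ord c.2).

(** Stated for an arbitrary code [i] of [q], because the initial code [ord0] is not the canonical
    code of the start state. *)
Lemma machine_step i q l r : ord_mstate i = q -> ~~ halted q ->
  @tm_step machine (i, map tsym_ord l, map tsym_ord r) = encode (mstep (q, l, r)).
Proof.
move=> iq /negPf qD; rewrite /mstep /= iq qD.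
have -> : head ord0 (map tsym_ord r) = tsym_ord (head None r) by case: r.
rewrite tsym_ordK; case: (delta _ _) => [[q' b] [||]]; rewrite /encode /= behead_map //.
by case: l.
Qed.

Lemma machine_encode c : @tm_step machine (encode c) = encode (mstep c).
Proof.
case: c => [[q l] r]; have [qD|qD] := boolP (halted q); last first.
  by rewrite (machine_step _ _ (mstate_ordK q)).
by rewrite /mstep qD /= mstate_ordK qD.
Qed.

Definition minit (w : seq sym) : mconfig := (mstart, [::], [seq Some (inl s) | s <- w]).

(** At least one step is required: only then is the state given by its canonical code, as in the
    image of [encode]. *)
Lemma machine_init w k :
  iter k.+1 (@tm_step machine) (tm_init machine w) = encode (iter k.+1 mstep (minit w)).
Proof.
rewrite !iterSr.
have -> : tm_init machine w =
    (ord0, map tsym_ord [::], map tsym_ord [seq Some (inl a) | a <- w]).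
  by rewrite -map_comp.
rewrite (machine_step _ _ ord_mstate0) //.
by elim: k (mstep _) => //= k IHk c; rewrite IHk machine_encode.
Qed.

Lemma read_out_raw (o : seq sym) (r : seq tsym) :
  head None r = None ->
  read_out (map tsym_ord ([seq Some (inl a) | a <- o] ++ r)) = o.
Proof.
move=> r0; elim: o => [|a o IHo] /=; last by rewrite code_sym_sym_code IHo.
by case: r r0 => //= a r ->.
Qed.

End Machine.
End LoopLanguage.

(** * Simulation of single instructions *)

Section Simulation.
Variables (K : nat) (prg : seq (instr K)) (w : seq sym).
Local Notation M := (max_index w).
Local Notation step := (@mstep K prg).
Implicit Types (s : store K) (o : seq sym) (c : mconfig prg).

Definition reach (t : nat) c c' := exists2 n, n <= t & iter n step c = c'.

Lemma reach_trans t1 t2 c1 c2 c3 : reach t1 c1 c2 -> reach t2 c2 c3 -> reach (t1 + t2) c1 c3.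
Proof.
move=> [n1 le1 <-] [n2 le2 <-]; exists (n1 + n2); first exact: leq_add.
by rewrite addnC iterD.
Qed.

Lemma reach_le t t' c c' : t <= t' -> reach t c c' -> reach t' c c'.
Proof. by move=> tt' [n ln <-]; exists n => //; apply: leq_trans tt'. Qed.

Lemma scan_right (q : mstate prg) (l r1 r2 : seq (tsym K)) : ~~ halted q ->
  (forall i, i < size r1 -> delta q (nth None r1 i) = (q, nth None r1 i, MoveR)) ->
  iter (size r1) step (q, l, r1 ++ r2) = (q, catrev r1 l, r2).
Proof.
move=> /negPf nh; elim: r1 l => // a r1 IHr l dR.
by rewrite [size _]/= iterSr /= nh (dR 0) //= IHr // => i ir; apply: (dR i.+1).
Qed.

(** The blank at the left end is either explicit ([e = 1]) or created by walking off the finite list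
    ([e = 0]); both cases end in the same configuration. *)
Lemma scan_left (q q' : mstate prg) (l r : seq (tsym K)) (b : tsym K) e :
  ~~ halted q -> (forall a : tsym K, isSome a -> delta q a = (q, a, MoveL)) ->
  delta q None = (q', None, MoveR) -> e <= 1 -> all isSome l -> isSome b ->
  iter (size l).+2 step (q, l ++ nseq e None, b :: r) = (q', [:: None], catrev l (b :: r)).
Proof.
move=> /negPf nh dL d0 e1; elim: l b r => [|x l IHl] b r lS bS.
  by rewrite /= nh dL //; case: e e1 => [|[|]] //= _; rewrite nh d0.
case/andP: lS => xS lS; rewrite [size _]/= iterSr.
have -> : step (q, (x :: l) ++ nseq e None, b :: r) = (q, l ++ nseq e None, x :: b :: r).
  by rewrite /= nh dL.
exact: IHl.
Qed.

Lemma rewind (pre r : seq (tsym K)) (b : tsym K) (ph ph' : phase) (pc : 'I_(size prg).+1) e :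
  (ph, ph') \in [:: (PBack, PFind); (PRewind, PSet)] ->
  e <= 1 -> all isSome pre -> isSome b ->
  reach (size pre).+2 ((ph, pc), catrev pre (nseq e None), b :: r)
                      ((ph', pc), [:: None], pre ++ b :: r).
Proof.
move=> phs e1 preS bS; exists (size pre).+2 => //.
rewrite -[in LHS](size_rev pre) catrevE (@scan_left _ (ph', pc)) ?all_rev ?catrevE ?revK //.
- by move: phs; rewrite !inE => /orP[] /eqP[-> _].
- by case=> // a _; move: phs; rewrite !inE => /orP[] /eqP[-> _].
- by move: phs; rewrite !inE => /orP[] /eqP[-> ->].
Qed.

Lemma rewind_home (pre r : seq (tsym K)) (b : tsym K) (pc : 'I_(size prg).+1) :
  all isSome pre -> isSome b ->
  reach (size pre).+2 ((PBack, pc), catrev pre [:: None], b :: r)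
                      ((PFind, pc), [:: None], pre ++ b :: r).
Proof. by move=> preS bS; apply: (@rewind _ _ _ PBack PFind _ 1); rewrite ?inE ?eqxx. Qed.

Definition cell_at s j : cell K := (sym_at w j, [set x | s x == j]).

Definition cells s a n : seq (tsym K) := [seq Some (inr (cell_at s j)) | j <- iota a n].

Definition raw o : seq (tsym K) := [seq Some (inl a) | a <- o].

(** The normal form between two instructions: head on the first cell, one visited blank to its left,
    the output behind the cells. *)
Definition home a s o : mconfig prg :=
  ((PFind, inord a), [:: None], cells s 0 M.+1 ++ raw o).

Definition instr_at a (i : instr K) := a <= size prg /\ nth (IHalt K) prg a = i.

Lemma cellsD s a m n : cells s a (m + n) = cells s a m ++ cells s (a + m) n.
Proof. by rewrite /cells iotaD map_cat. Qed.

Lemma cells_split s v : v <= M ->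
  cells s 0 M.+1 = cells s 0 v ++ Some (inr (cell_at s v)) :: cells s v.+1 (M - v).
Proof. by move=> vM; rewrite -{1}(subnKC vM) -addnS cellsD. Qed.

Lemma size_cells s a n : size (cells s a n) = n.
Proof. by rewrite size_map size_iota. Qed.

Lemma nth_cells s a n i : i < n -> nth None (cells s a n) i = Some (inr (cell_at s (a + i))).
Proof. by move=> lin; rewrite (nth_map 0) ?size_iota // nth_iota. Qed.

Lemma all_cells s a n : all isSome (cells s a n).
Proof. by rewrite /cells all_map; apply/allP. Qed.

Lemma eq_cells s s' a n : (forall j, a <= j < a + n -> cell_at s j = cell_at s' j) ->
  cells s a n = cells s' a n.
Proof. by move=> ss'; apply/eq_in_map => j; rewrite mem_iota => /ss' ->. Qed.

Lemma cell_at_upd s x v j : j != s x -> j != v -> cell_at (upd s x v) j = cell_at s j.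
Proof.
move=> jx jv; congr (_, _); apply/setP => y; rewrite !inE updE.
by case: (y =P x) => // ->; rewrite eq_sym (negPf jv) eq_sym (negPf jx).
Qed.

Lemma mark_cell_at s x v : mark x (cell_at s v) = Some (inr (cell_at (upd s x v) v)).
Proof.
congr (Some (inr (_, _))); apply/setP => y; rewrite !inE updE.
by case: (y =P x) => //= _; rewrite eqxx.
Qed.

Lemma unmark_cell_at s x v :
  v != s x -> unmark x (cell_at s (s x)) = Some (inr (cell_at (upd s x v) (s x))).
Proof.
move=> /negPf vx; congr (Some (inr (_, _))); apply/setP => y; rewrite !inE updE.
by case: (y =P x) => //= _; rewrite vx.
Qed.

(** Lets the machine recognise the maximal counter value from the symbol of a single cell. *)
Lemma sym_at_end2 j : j <= M -> (sym_at w j == end2) = (j == M).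
Proof.
rewrite /sym_at /max_index => jM; rewrite nth_rcons size_map.
case: ltngtP => [jw|jw|->].
- rewrite (nth_map S0) // /sym_index /end2.
  by case: (nth _ _ _); rewrite inord5_eq //; lia.
- by rewrite eqxx; lia.
- by rewrite /end1 /end2 inord5_eq //; lia.
Qed.

Lemma find_cell (pc : 'I_(size prg).+1) s o v : v <= M ->
  (forall j, j < v -> delta (PFind, pc) (Some (inr (cell_at s j)))
                      = ((PFind, pc), Some (inr (cell_at s j)), MoveR)) ->
  reach v ((PFind, pc), [:: None], cells s 0 M.+1 ++ raw o)
    ((PFind, pc), catrev (cells s 0 v) [:: None],
     Some (inr (cell_at s v)) :: cells s v.+1 (M - v) ++ raw o).
Proof.
move=> vM dR; exists v => //.
rewrite (cells_split _ vM) -catA /= -[in iter v](size_cells s 0 v) scan_right //.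
by move=> i; rewrite size_cells => iv; rewrite nth_cells // dR.
Qed.

(** One walk to the far end of the output and one back; the constant absorbs the turns. *)
Definition instr_time o := 2 * (M + size o) + 10.

Lemma step_nop a k s o : instr_at a (INop K k) ->
  reach (instr_time o) (home a s o) (home k s o).
Proof. by move=> [ale ai]; exists 1; rewrite //= inordK // ai. Qed.

Lemma reach_step c c' : step c = c' -> reach 1 c c'.
Proof. by move=> <-; exists 1. Qed.

Lemma step_if a t k1 k2 s o : bounded w s -> instr_at a (IIf t k1 k2) ->
  reach (instr_time o) (home a s o) (home (if teval w s t then k1 else k2) s o).
Proof.
move=> bs [ale ai].
(* For a comparison, [v] is the smaller of the two counters; for a symbol test it is the counter
   itself. *)
have [v vM [dv dj]] : exists2 v, v <= M & decide t (cell_at s v) = Some (teval w s t)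
    /\ forall j, j < v -> decide t (cell_at s j) = None.
  case: t {ai} => [x y|x y|x b] /=; rewrite /decide /=.
  - have [xy|xy|xy] := ltngtP (s x) (s y).
    + exists (s x); rewrite ?bs //; split=> [|j jv]; rewrite !inE ?eqxx ?gtn_eqF //; lia.
    + exists (s y); rewrite ?bs //; split=> [|j jv]; rewrite !inE ?eqxx ?gtn_eqF //; lia.
    + exists (s x); rewrite ?bs //; split=> [|j jv]; rewrite !inE -?xy ?eqxx ?gtn_eqF //; lia.
  - have [xy|xy|xy] := ltngtP (s x) (s y).
    + exists (s x); rewrite ?bs //; split=> [|j jv]; rewrite !inE ?eqxx ?gtn_eqF //; lia.
    + exists (s y); rewrite ?bs //; split=> [|j jv]; rewrite !inE ?eqxx ?gtn_eqF //; lia.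
    + exists (s x); rewrite ?bs //; split=> [|j jv]; rewrite !inE -?xy ?eqxx ?gtn_eqF //; lia.
  - exists (s x); first exact: bs.
    by split=> [|j jv]; rewrite !inE ?eqxx //; case: ltngtP jv.
have aO : nat_of_ord (inord a : 'I_(size prg).+1) = a by rewrite inordK.
apply: reach_le; last apply: (reach_trans (find_cell (v := v) _ _ _)) => //; last 1 first.
- apply: (reach_trans (reach_step _)).
    by rewrite /= aO ai dv.
  rewrite /home (cells_split _ vM) -catA /=.
  by apply: rewind_home => //; apply: all_cells.
- by rewrite size_cells /instr_time; lia.
- by move=> j jv; rewrite /= aO ai dj.
Qed.

Lemma step_out a b k s o : instr_at a (IOut K b k) ->
  reach (instr_time o) (home a s o) (home k s (rcons o b)).
Proof.
move=> [ale ai].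
have aO : nat_of_ord (inord a : 'I_(size prg).+1) = a by rewrite inordK.
set t := cells s 0 M.+1 ++ raw o.
have tS : all isSome t.
  by rewrite all_cat all_cells /=; elim: (o).
have st : size t = M.+1 + size o by rewrite size_cat size_cells size_map.
apply: (@reach_le (size t + (1 + (size t).+2))); first by rewrite st /instr_time; lia.
apply: (@reach_trans _ _ _ ((PFind, inord a), catrev t [:: None], [::])).
  exists (size t) => //; rewrite /home -/t -{2}[t]cats0 scan_right // => i it.
  have := all_nthP None tS i it.
  by rewrite /= aO ai; case: (nth _ _ _) => // [[]].
apply: (reach_trans (reach_step _)).
  by rewrite /= aO ai.
rewrite /home /raw map_rcons -cats1 catA -/t.
exact: rewind_home.
Qed.

Lemma step_inc a x k s o : bounded w s -> instr_at a (IInc x k) ->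
  reach (instr_time o) (home a s o) (home k (inc w s x) o).
Proof.
move=> bs [ale ai].
have aO : nat_of_ord (inord a : 'I_(size prg).+1) = a by rewrite inordK.
have dj j : j < s x -> x \notin (cell_at s j).2 by rewrite inE; case: ltngtP.
have dx : x \in (cell_at s (s x)).2 by rewrite inE.
apply: (@reach_le (s x + ((s x + 5) + 0))); first by have := bs x; rewrite /instr_time; lia.
apply: reach_trans.
  apply: (find_cell _ (bs x)) => j jx; by rewrite /= aO ai (negPf (dj j jx)).
rewrite addn0.
(* At the maximum the machine leaves the mark in place, in accordance with the saturation of
   [inc]. *)
have [sM|sM] := eqVneq (s x) M.
  apply: (@reach_le (1 + (s x).+2)); first lia.
  apply: (@reach_trans 1 _ _ ((PBack, inord k), catrev (cells s 0 (s x)) [:: None],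
            Some (inr (cell_at s (s x))) :: cells s (s x).+1 (M - s x) ++ raw o)).
    by apply: reach_step; rewrite /= aO ai dx sym_at_end2 // sM eqxx.
  have -> : inc w s x = s.
    by rewrite /inc sM (minn_idPr (leqnSn _)) -sM upd_id.
  rewrite /home (cells_split s (bs x)) -catA /= -[in (s x).+2](size_cells s 0 (s x)).
  by apply: rewind_home => //; apply: all_cells.
have sxM : s x < M by have := bs x; case: ltngtP sM.
have dif : (s x).+1 != s x by rewrite neq_ltn ltnSn orbT.
set s' := inc w s x; have s'E : s' = upd s x (s x).+1 by rewrite /s' /inc (minn_idPl sxM).
(* Moving the mark changes only the cells [s x] and [s x + 1]; the tape is split around these
   two. *)
have E1 : cells s' 0 (s x).+1 = rcons (cells s 0 (s x)) (Some (inr (cell_at s' (s x)))).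
  rewrite -addn1 cellsD cats1; congr rcons.
  by apply: eq_cells => j jx; rewrite s'E cell_at_upd //; lia.
have E2 : cells s' (s x).+2 (M - (s x).+1) = cells s (s x).+2 (M - (s x).+1).
  by apply: eq_cells => j jx; rewrite s'E cell_at_upd //; lia.
have -> : cells s (s x).+1 (M - s x) ++ raw o
   = Some (inr (cell_at s (s x).+1)) :: cells s' (s x).+2 (M - (s x).+1) ++ raw o.
  by rewrite E2 (_ : M - s x = (M - (s x).+1).+1) //; lia.
apply: (@reach_le (1 + (1 + (s x).+3))); first lia.
apply: (@reach_trans 1 _ _ ((PPut, inord a), catrev (cells s' 0 (s x).+1) [:: None],
          Some (inr (cell_at s (s x).+1)) :: cells s' (s x).+2 (M - (s x).+1) ++ raw o)).
  apply: reach_step; rewrite E1 s'E -(unmark_cell_at dif) [in RHS]catrevE rev_rcons /= -catrevE.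
  by rewrite aO ai dx sym_at_end2 // (negPf sM).
apply: (@reach_trans 1 _ _ ((PBack, inord k), catrev (cells s' 0 (s x).+1) [:: None],
          Some (inr (cell_at s' (s x).+1)) :: cells s' (s x).+2 (M - (s x).+1) ++ raw o)).
  apply: reach_step; move: (cells s' 0 _) => u; move: (cells s' _ _) => v.
  by rewrite /= aO ai mark_cell_at -s'E.
rewrite /home (cells_split s' sxM) -catA /=.
rewrite -[X in X.+2](size_cells s' 0 (s x).+1).
by apply: rewind_home; rewrite ?all_cells.
Qed.

Lemma step_zero a x k s o : bounded w s -> instr_at a (IZero x k) ->
  reach (instr_time o) (home a s o) (home k (upd s x 0) o).
Proof.
move=> bs [ale ai].
have aO : nat_of_ord (inord a : 'I_(size prg).+1) = a by rewrite inordK.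
have dj j : j < s x -> x \notin (cell_at s j).2 by rewrite inE; case: ltngtP.
have dx : x \in (cell_at s (s x)).2 by rewrite inE.
apply: (@reach_le (s x + (1 + ((s x).+2 + 1)))); first by have := bs x; rewrite /instr_time; lia.
apply: reach_trans.
  apply: (find_cell _ (bs x)) => j jx; by rewrite /= aO ai (negPf (dj j jx)).
apply: (reach_trans (reach_step _)); first by rewrite /= aO ai dx.
apply: reach_trans.
  rewrite -[in (s x).+2](size_cells s 0 (s x)).
  by apply: (@rewind _ _ _ PRewind PSet _ 1); rewrite ?all_cells // !inE eqxx orbT.
apply: reach_step.
(* If the counter is already 0, the mark is erased from and restored to the same cell, so the
   argument with two distinct cells does not apply. *)
have [s0|s0] := eqVneq (s x) 0.
  have us : upd s x 0 = s by rewrite -[RHS](upd_id s x) s0.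
  by rewrite us s0 /= aO ai /mark /= setD1K // inE s0.
have dif : 0 != s x by rewrite eq_sym.
rewrite /home (cells_split (upd s x 0) (bs x)) -catA /=.
have split0 s' : cells s' 0 (s x) = Some (inr (cell_at s' 0)) :: cells s' 1 (s x).-1.
  by rewrite -{1}(prednK (_ : 0 < s x)) ?lt0n.
rewrite !split0 /= aO ai mark_cell_at (unmark_cell_at dif).
congr (_, _, _ :: _ ++ _ :: _ ++ _).
  by apply: eq_cells => j jx; rewrite cell_at_upd //; lia.
by apply: eq_cells => j jx; rewrite cell_at_upd //; lia.
Qed.

(** The head stops right behind the last cell, at the first output symbol, which is where [read_out]
    starts. *)
Lemma halt_reach s o : reach M.+2 (home (size prg) s o)
  ((PDone, inord (size prg)), catrev (cells s 0 M.+1) [:: None], raw o).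
Proof.
have aO : nat_of_ord (inord (size prg) : 'I_(size prg).+1) = size prg by rewrite inordK.
have hi : nth (IHalt K) prg (size prg) = IHalt K by rewrite nth_default.
apply: (@reach_le (M + 1)); first lia.
apply: reach_trans.
  apply: (find_cell _ (leqnn M)) => j jM.
  by rewrite /= aO hi sym_at_end2 ?(ltnW jM) // ltn_eqF.
have -> : catrev (cells s 0 M.+1) [:: None]
    = Some (inr (cell_at s M)) :: catrev (cells s 0 M) [:: None].
  by rewrite -[in M.+1]addn1 cellsD !catrevE rev_cat.
by apply: reach_step; rewrite subnn /= aO hi sym_at_end2 // eqxx.
Qed.

End Simulation.

(** One pass over the input writes the cells; all marks sit on the first one since every counter
    starts at 0. *)
Lemma init_reach (K : nat) (prg : seq (instr K)) (w : seq sym) :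
  reach (2 * max_index w + 5) (minit prg w) (home prg w 0 (zero_store K) [::]).
Proof.
set z := zero_store K; set M := max_index w.
have inord0 : inord 0 = ord0 :> 'I_(size prg).+1 by apply: val_inj; rewrite /= inordK.
have zE j : [set x | z x == j] = if j == 0 then setT else set0.
  by case: j => [|j]; apply/setP => x; rewrite !inE ffunE.
have scan u pc (l : seq (tsym K)) : iter (size u) (@mstep K prg) ((PInit, pc), l, raw K u)
    = ((PInit, pc), catrev [seq Some (inr (sym_index a, set0)) | a <- u] l, [::]).
  by elim: u l => // a u IHu l; rewrite [size _]/= iterSr -IHu.
have pass : reach M (minit prg w) ((PEnd, ord0), catrev (cells w z 0 M) [::], [::]).
  exists M => //; rewrite /M /max_index /minit iterSr.
  (* On empty input the first cell, which gets all marks, is already the one carrying [end1]. *)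
  case: {M} w => [|a u].
    by rewrite /cells /= /cell_at zE.
  have -> : cells (a :: u) z 0 (size (a :: u)).+1 = rcons
      (Some (inr (sym_index a, setT)) :: [seq Some (inr (sym_index a, set0)) | a <- u])
      (Some (inr (end1, set0))).
    apply: (@eq_from_nth _ None); first by rewrite size_cells size_rcons /= size_map.
    move=> i; rewrite size_cells => iu; rewrite nth_cells // nth_rcons /cell_at zE add0n /=.
    rewrite size_map; case: i iu => [|i] //= iu.
    rewrite /sym_at /= ltnS eqSS nth_rcons size_map.
    have [ilt|//] := ltnP; last by case: eqP => // *; lia.
    by rewrite !(nth_map S0).
  rewrite [size _]/= iterS.
  have -> : mstep (mstart prg, [::], raw K (a :: u))
    = ((PInit, ord0), [:: Some (inr (sym_index a, setT))], raw K u) by [].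
  by rewrite scan [in RHS]catrevE rev_rcons /= -catrevE.
apply: (@reach_le _ _ (M + (1 + M.+2))); first by lia.
apply: (reach_trans pass).
apply: (@reach_trans _ _ 1 _ _ ((PBack, ord0), catrev (cells w z 0 M) [::],
   [:: Some (inr (cell_at w z M))])).
  have wM : sym_at w M = end2 by apply/eqP; rewrite sym_at_end2.
  have M0 : (M == 0) = false by [].
  by apply: reach_step; rewrite /cell_at zE wM M0.
rewrite /home inord0 (@cells_split _ w z _ (leqnn M)) -catA subnn /=.
rewrite -[in M.+2](size_cells w z 0 M).
(* The square to the left of the input has not been visited yet, hence the exponent 0. *)
by apply: (@rewind _ _ _ _ _ PBack PFind _ 0); rewrite ?all_cells // !inE eqxx.
Qed.

(** * Compilation *)

Section Compiler.
Variable K : nat.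

Fixpoint code_size (p : prog K) : nat :=
  match p with
  | Seq p q => code_size p + code_size q
  | If _ p q => (code_size p + code_size q).+1
  | For _ p => (code_size p).+3
  | _ => 1
  end.

(* The code sits at address [a] and leaves to address [k]. *)
Fixpoint compile (p : prog K) (a k : nat) : seq (instr K) :=
  match p with
  | Skip => [:: INop K k]
  | Inc x => [:: IInc x k]
  | Zero x => [:: IZero x k]
  | Out b => [:: IOut K b k]
  | Seq p q => compile p a (a + code_size p) ++ compile q (a + code_size p) k
  | If t p q => IIf t a.+1 (a.+1 + code_size p)
                  :: compile p a.+1 k ++ compile q (a.+1 + code_size p) k
  | For x p => let b := a.+1 + code_size p in
               IZero x a.+1 :: compile p a.+1 b
                 ++ [:: IIf (TSym x end2) k b.+1; IInc x a.+1]
  end.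

Lemma size_compile p a k : size (compile p a k) = code_size p.
Proof.
elim: p a k => //= [p IHp q IHq|t p IHp q IHq|x p IHp] a k.
- by rewrite size_cat IHp IHq.
- by rewrite size_cat IHp IHq.
- by rewrite size_cat IHp addn2.
Qed.

Section Correctness.
Variables (prg : seq (instr K)) (w : seq sym).
Local Notation M := (max_index w).

Definition placed (a : nat) (c : seq (instr K)) :=
  forall i, i < size c -> instr_at prg (a + i) (nth (IHalt K) c i).

Lemma placed_cons a i c : placed a (i :: c) -> instr_at prg a i /\ placed a.+1 c.
Proof.
move=> pl; split; first by have := pl 0; rewrite addn0; apply.
by move=> j jc; rewrite addSnnS; apply: (pl j.+1).
Qed.

Lemma placed_cat a c1 c2 : placed a (c1 ++ c2) -> placed a c1 /\ placed (a + size c1) c2.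
Proof.
move=> pl; split=> j jc.
  by have := pl j; rewrite nth_cat jc; apply; rewrite size_cat ltn_addr.
have := pl (size c1 + j); rewrite size_cat ltn_add2l => /(_ jc).
by rewrite nth_cat ltnNge leq_addr addKn addnA.
Qed.

(** [B] bounds the output throughout the run, so every instruction takes at most the same time [D]
    and it remains to count instructions, by induction on the program. *)
Lemma compile_correct p a k s o B : placed a (compile p a k) -> wf p -> bounded w s ->
  size o + size (run w p s).2 <= B ->
  reach (cost p M * (2 * (M + B) + 10))
    (home prg w a s o) (home prg w k (run w p s).1 (o ++ (run w p s).2)).
Proof.
set D := 2 * (M + B) + 10.
have instr_le o' : size o' <= B -> instr_time w o' <= D.
  by rewrite /instr_time /D; lia.
elim: p a k s o => [|x|x|b|p IHp q IHq|t p IHp q IHq|x p IHp] a k s o.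
- move=> /placed_cons[ia _] _ bs; rewrite /= addn0 cats0 mul1n => oB.
  by apply: reach_le (instr_le _ oB) _; apply: step_nop.
- move=> /placed_cons[ia _] _ bs; rewrite /= addn0 cats0 mul1n => oB.
  by apply: reach_le (instr_le _ oB) _; apply: step_inc.
- move=> /placed_cons[ia _] _ bs; rewrite /= addn0 cats0 mul1n => oB.
  by apply: reach_le (instr_le _ oB) _; apply: step_zero.
- move=> /placed_cons[ia _] _ bs; rewrite /= cats1 mul1n => oB.
  apply: reach_le (instr_le o _) _; last exact: step_out.
  by apply: leq_trans oB; rewrite leq_addr.
- move=> /placed_cat[]; rewrite size_compile => pp pq /andP[wp wq] bs oB.
  move: oB; rewrite [run _ _ _]/= size_cat catA => oB.
  apply: (@reach_le _ _ (cost p M * D + cost q M * D)); first by rewrite /=; nia.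
  apply: reach_trans (IHp _ _ _ _ pp wp bs _) (IHq _ _ _ _ pq wq _ _).
  + by lia.
  + exact: run_bounded.
  + by rewrite size_cat; lia.
- move=> /placed_cons[ia] /placed_cat[]; rewrite size_compile => pp pq /andP[wp wq] bs oB.
  apply: (@reach_le _ _ (D + (cost p M + cost q M) * D)); first by rewrite /=; nia.
  apply: reach_trans (reach_le (instr_le o _) (step_if _ bs ia)) _; first by lia.
  move: oB; rewrite /=; case: ifP => _ oB.
    by apply: reach_le (IHp _ _ _ _ pp wp bs oB); rewrite leq_mul // leq_addr.
  by apply: reach_le (IHq _ _ _ _ pq wq bs oB); rewrite leq_mul // leq_addl.
- move=> /placed_cons[iz] /placed_cat[pp]; rewrite size_compile.
  move=> /placed_cons[ii] /placed_cons[ic _] /andP[xp wp] bs.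
  rewrite run_For; set st0 := (_, _); pose st i := iter i (loop_body w p x) st0.
  rewrite -/(st M.+1) => oB.
  have szS i : size (st i.+1).2 = size (st i).2 + size (run w p (st i).1).2.
    by rewrite /st iterS /= size_cat.
  have sz i : i <= M.+1 -> size (st i).2 <= size (st M.+1).2.
    move=> iM; rewrite -(subnKC iM); elim: (M.+1 - i) => [|d IHd]; first by rewrite addn0.
    by apply: leq_trans IHd _; rewrite addnS szS leq_addr.
  have bst i : bounded w (st i).1.
    refine (iter_inv (P := fun so : store K * seq sym => bounded w so.1) _ _ _) => [so bso|].
      exact/bounded_inc/run_bounded.
    exact: bounded_upd.
  have stx i : i <= M -> (st i).1 x = i.
    elim: i => [|i IHi] iM; first by rewrite /st /= upd_same.
    rewrite /st iterS /= /inc upd_same run_frame // -/(st i) IHi ?(ltnW iM) //.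
    exact/minn_idPl.
  have body i : i <= M -> reach (cost p M * D) (home prg w a.+1 (st i).1 (o ++ (st i).2))
      (home prg w (a.+1 + code_size p) (run w p (st i).1).1
         (o ++ (st i).2 ++ (run w p (st i).1).2)).
    move=> iM; rewrite catA; apply: IHp => //.
    by have := sz i.+1 iM; rewrite szS size_cat; lia.
  have test i : i <= M -> teval w (run w p (st i).1).1 (TSym x end2) = (i == M).
    by move=> iM; rewrite /= run_frame // stx // sym_at_end2.
  have tm i : i <= M -> instr_time w (o ++ (st i).2 ++ (run w p (st i).1).2) <= D.
    move=> iM; apply: instr_le; rewrite !size_cat; apply: leq_trans oB.
    by rewrite leq_add2l -szS; apply: sz.
  have loop i : i <= M -> reach (D + i * ((cost p M).+2 * D)) (home prg w a s o)
      (home prg w a.+1 (st i).1 (o ++ (st i).2)).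
    elim: i => [_|i IHi iM].
      rewrite mul0n addn0 /= cats0; apply: reach_le (instr_le o _) _; first lia.
      exact: step_zero.
    rewrite mulSn [X in D + X]addnC addnA.
    apply: reach_trans (IHi (ltnW iM)) _.
    apply: (@reach_le _ _ (cost p M * D + (D + D))); first by lia.
    apply: reach_trans (body i (ltnW iM)) _.
    apply: reach_trans (reach_le (tm i (ltnW iM)) (step_if _ (run_bounded _ (bst i)) ii)) _.
    rewrite test ?(ltnW iM) // (ltn_eqF iM).
    apply: reach_le (tm i (ltnW iM)) _.
    exact: step_inc (run_bounded _ (bst i)) ic.
  apply: (@reach_le _ _ (D + M * ((cost p M).+2 * D) + (cost p M * D + D))).
    by rewrite [cost (For _ _) _]/=; nia.
  apply: reach_trans (loop M (leqnn M)) (reach_trans (body M (leqnn M)) _).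
  apply: reach_le (tm M (leqnn M)) _.
  have rx : (run w p (st M).1).1 x = M by rewrite run_frame // stx.
  (* The machine leaves the loop before the last increment, which the semantics still performs; at
     the maximal value that increment changes nothing. *)
  have -> : st M.+1 = ((run w p (st M).1).1, (st M).2 ++ (run w p (st M).1).2).
    rewrite {1}/st iterS -/(st M) /loop_body; congr (_, _).
    by rewrite /inc rx (minn_idPr (leqnSn M)) -[X in upd _ _ X]rx upd_id.
  have := step_if (o ++ (st M).2 ++ (run w p (st M).1).2) (run_bounded p (bst M)) ii.
  by rewrite test // eqxx.
Qed.

End Correctness.
End Compiler.

(** * Polynomial time *)

(** The base [n.+1] is positive even for [n = 0], so raising the exponent only weakens the bound. *)
Definition poly_bounded (f : nat -> nat) := exists C e, forall n, f n <= C * n.+1 ^ e.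

Lemma poly_boundedD f g : poly_bounded f -> poly_bounded g -> poly_bounded (fun n => f n + g n).
Proof.
move=> [C [e fC]] [C' [e' gC]]; exists (C + C'), (e + e') => n.
rewrite mulnDl leq_add //.
- by apply: leq_trans (fC n) _; rewrite leq_mul // leq_pexp2l // leq_addr.
- by apply: leq_trans (gC n) _; rewrite leq_mul // leq_pexp2l // leq_addl.
Qed.

Lemma poly_boundedM f g : poly_bounded f -> poly_bounded g -> poly_bounded (fun n => f n * g n).
Proof.
move=> [C [e fC]] [C' [e' gC]]; exists (C * C'), (e + e') => n.
by rewrite expnD mulnACA leq_mul.
Qed.

Lemma poly_bounded_const c : poly_bounded (fun=> c).
Proof. by exists c, 0 => n; rewrite expn0 muln1. Qed.

Lemma poly_bounded_id : poly_bounded id.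
Proof. by exists 1, 1 => n; rewrite mul1n expn1. Qed.

Lemma eq_poly_bounded f g : f =1 g -> poly_bounded f -> poly_bounded g.
Proof. by move=> fg [C [e fC]]; exists C, e => n; rewrite -fg. Qed.

Lemma poly_bounded_cost K (p : prog K) : poly_bounded (cost p).
Proof.
have S f : poly_bounded f -> poly_bounded (fun n => (f n).+1).
  move=> pf; apply: eq_poly_bounded (poly_boundedD pf (poly_bounded_const 1)) => n.
  by rewrite addn1.
elim: p => [|x|x|a|p IHp q IHq|t p IHp q IHq|x p IHp]; try exact: (poly_bounded_const 1).
- exact/S/poly_boundedD.
- exact/S/poly_boundedD.
- exact: S (poly_boundedM (S _ poly_bounded_id) (S _ (S _ IHp))).
Qed.

(** For [n >= 2] one has [C <= n ^ C] and [n + 2 <= n ^ 2]; for [n <= 1] the additive [d] absorbs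
    [C * 3 ^ e]. The argument [n.+1] is the value of [max_index] on inputs of length [n]. *)
Lemma poly_bounded_exp f : poly_bounded f -> exists d, forall n, f n.+1 <= n ^ d + d.
Proof.
move=> [C [e fC]]; exists (C + 2 * e + C * 3 ^ e) => n.
apply: leq_trans (fC _) _.
have [n1|n2] := leqP n 1.
  have : n.+2 ^ e <= 3 ^ e by case: (e) => // e'; rewrite leq_exp2r.
  by move=> le3; have := leq_mul (leqnn C) le3; lia.
have : C * n.+2 ^ e <= n ^ (C + 2 * e).
  rewrite expnD expnM leq_mul //.
    by apply: leq_trans (ltnW (ltn_expl C (ltnSn 1))) _; case: (C) => // c; rewrite leq_exp2r.
  have n22 : n.+2 <= n ^ 2 by rewrite expnS expn1; nia.
  by case: (e) => // e'; rewrite leq_exp2r.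
move=> le; apply: leq_trans le _; apply: leq_trans (leq_addr _ _).
by rewrite leq_pexp2l ?leq_addr //; lia.
Qed.

Theorem poly_time_transduce K (p : prog K) : wf p -> poly_time (transduce p).
Proof.
(* The exit address lies just behind the code, where the default instruction is [IHalt]. *)
move=> wp; pose prg := compile p 0 (code_size p).
have sprg : size prg = code_size p by rewrite size_compile.
(* Initialisation, the run itself and the final scan. The output starts empty, so [cost p M] also
   serves as the bound on its length. *)
pose T M := (2 * M + 5) + cost p M * (2 * (M + cost p M) + 10) + M.+2.
have [d dP] : exists d, forall n, T n.+1 <= n ^ d + d.
  apply: poly_bounded_exp; have pc := poly_bounded_cost p.
  have pC := poly_bounded_const; have pI := poly_bounded_id.
  apply: eq_poly_bounded (poly_boundedD (poly_boundedD (poly_boundedD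
    (poly_boundedM (pC 2) pI) (pC 5)) (poly_boundedM pc (poly_boundedD (poly_boundedM
    (pC 2) (poly_boundedD pI pc)) (pC 10)))) (poly_boundedD pI (pC 2))) => n.
  by rewrite /T addn2.
exists (machine prg), d => w; exists (T (max_index w)); split; first exact: dP.
set z := zero_store K; set r := run w p z.
have pl : placed prg 0 prg by move=> i ip; split; rewrite ?add0n // ltnW.
have bz : bounded w z by move=> x; rewrite ffunE.
have [n nT nE] : reach (T (max_index w)) (minit prg w) ((PDone, inord (size prg)),
    catrev (cells w r.1 0 (max_index w).+1) [:: None], raw K r.2).
  apply: reach_trans (reach_trans (init_reach prg w) _) _; last exact: halt_reach.
  have := @compile_correct _ prg w p 0 (code_size p) z [::] (cost p (max_index w)) pl wp bz.
  by rewrite add0n sprg; apply; apply: size_run.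
(* A halted machine no longer moves, so reaching the configuration within [T] steps gives it after
   exactly [T] steps. *)
have haltE : iter (T (max_index w)) (@mstep K prg) (minit prg w) = ((PDone, inord (size prg)),
    catrev (cells w r.1 0 (max_index w).+1) [:: None], raw K r.2).
  by rewrite -(subnK nT) iterD nE; elim: (_ - _) => //= j ->.
have [t tE] : exists t, T (max_index w) = t.+1 by rewrite /T addnS; eexists.
rewrite /tm_computes_in tE machine_init -tE haltE /=; split.
  by rewrite mstate_ordK.
by have := @read_out_raw K r.2 [::] erefl; rewrite cats0.
Qed.

(** * The graph construction *)

Lemma isomorphic_sym n m (E : rel 'I_n) (F : rel 'I_m) : isomorphic E F -> isomorphic F E.
Proof.
by case=> f [[g fK gK] fE]; exists g; split=> [|i j]; [exists f | rewrite fE !gK].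
Qed.

Lemma isomorphic_trans n m k (E : rel 'I_n) (F : rel 'I_m) (H : rel 'I_k) :
  isomorphic E F -> isomorphic F H -> isomorphic E H.
Proof.
move=> [f [bf fE]] [g [bg gE]]; exists (g \o f); split; first exact: bij_comp.
by move=> i j; rewrite fE gE.
Qed.

Lemma isomorphic_size n m (E : rel 'I_n) (F : rel 'I_m) : isomorphic E F -> n = m.
Proof. by case=> f [bf _]; rewrite -(card_ord n) -(card_ord m); exact: bij_eq_card bf. Qed.

Section Gadget.
Variables (n : nat) (E : rel 'I_n).

(* [(None, i, i)] is the vertex [i] and [(None, i, j)] the arc from [i] to [j];
   [(Some true, i, j)] and [(Some false, i, j)] are the flags joining this arc
   to its tail and to its head.  The flags at [(i, i)] are pendant at [i]; those at
   distinct non-adjacent [i], [j] are isolated and only keep the indexing regular. *)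
Definition vtx : finType := (option bool * 'I_n * 'I_n)%type.

(** Says that the flag [(Some b, i, j)] sees [(None, k, l)]: the first alternative is its arc, the
    second the end of the arc chosen by [b]. For [i = j] both describe the vertex [i], which makes
    these flags pendant. *)
Definition incident (b : bool) (i j k l : 'I_n) : bool :=
  ((i == j) || E i j)
  && ((k == i) && (l == j) || (k == l) && (k == if b then i else j)).

Definition gadget : rel vtx := fun u v =>
  match u, v with
  | (None, i, j), (None, k, l) => (i == j) != (k == l)
  | (Some b, i, j), (None, k, l) => incident b i j k l
  | (None, k, l), (Some b, i, j) => incident b i j k l
  | (Some _, _, _), (Some _, _, _) => false
  end.

Definition kind := option bool.
Definition KVertex : kind := Some true.
Definition KArc : kind := Some false.
Definition KFlag : kind := None.

Definition kind_of (u : vtx) : kind :=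
  match u with
  | (None, i, j) => if i == j then KVertex else KArc
  | (Some _, _, _) => KFlag
  end.

Lemma gadget_sym u v : gadget u v = gadget v u.
Proof. by move: u v => [[[b|] i] j] [[[c|] k] l] //=; rewrite eq_sym. Qed.

Lemma gadget_kind u v : gadget u v -> kind_of u <> kind_of v.
Proof.
by move: u v => [[[b|] i] j] [[[c|] k] l] //=; case: (i == j); case: (k == l).
Qed.

Lemma gadget_vertex_arc u v : kind_of u = KVertex -> kind_of v = KArc -> gadget u v.
Proof.
by move: u v => [[[b|] i] j] [[[c|] k] l] //=; case: (i == j); case: (k == l).
Qed.

Lemma incidentE b i j k l : incident b i j k l -> k = l -> k = if b then i else j.
Proof.
case/andP=> _ /orP[/andP[/eqP-> /eqP->] ->|/andP[_ /eqP->]] //; by case: b.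
Qed.

Lemma incident_arc b i j k l : incident b i j k l -> k != l -> k = i /\ l = j.
Proof. by case/andP=> _ /orP[/andP[/eqP-> /eqP->]|/andP[/eqP->]] //; rewrite eqxx. Qed.

(** The indices of a flag determine its only possible arc, and together with its tag its only
    possible vertex; flags see no flags. *)
Lemma flag_neighbour_unique z u v : kind_of z = KFlag -> gadget z u -> gadget z v ->
  kind_of u = kind_of v -> u = v.
Proof.
move: z u v => [[[b|] i] j] [[[c|] k] l] [[[d|] k'] l'] //=; try by do ?case: ifP.
move=> _ zu zv; have [kl|kl] := eqVneq k l; have [kl'|kl'] := eqVneq k' l' => // _.
  by have := incidentE zu kl; rewrite -kl -kl' -(incidentE zv kl') => ->.
have [-> ->] := incident_arc zu kl; by have [-> ->] := incident_arc zv kl'.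
Qed.

(** The arc gives the indices of the flag; its two ends differ, so the vertex gives the tag. *)
Lemma flag_unique x y z z' : kind_of x = KVertex -> kind_of y = KArc ->
  kind_of z = KFlag -> kind_of z' = KFlag ->
  gadget z x -> gadget z y -> gadget z' x -> gadget z' y -> z = z'.
Proof.
move: x y z z' => [[[?|] m] m'] [[[?|] k] l] [[[b|] i] j] [[[b'|] i'] j'] //=; try by do ?case: ifP.
case: eqP => // mm' _; case: eqVneq => // kl _ _ _ zx zy z'x z'y.
have [ki lj] := incident_arc zy kl; have [ki' lj'] := incident_arc z'y kl.
subst i j i' j'; have := incidentE zx mm'; rewrite (incidentE z'x mm').
by case: b b' {zx zy z'x z'y} => [] [] //; [move/esym|]; move=> kl'; rewrite kl' eqxx in kl.
Qed.

(** Adjacent elements differ in kind, so [a] and [b] both have the third kind besides those of [u]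
    and [v]. Either they are flags and [flag_unique] applies, or one of [u], [v] is a flag and sees
    only one element of that kind. *)
Lemma common_neighbour_unique u v a b :
  gadget u v -> gadget a u -> gadget a v -> gadget b u -> gadget b v -> a = b.
Proof.
move=> uv au av bu bv.
have kuv := gadget_kind uv; have kau := gadget_kind au; have kav := gadget_kind av.
have kbu := gadget_kind bu; have kbv := gadget_kind bv.
have un := flag_neighbour_unique; have fl := flag_unique.
case ku : (kind_of u) => [[]|]; case kv : (kind_of v) => [[]|];
  case ka : (kind_of a) => [[]|]; case kb : (kind_of b) => [[]|];
  move: (kuv) (kau) (kav) (kbu) (kbv); rewrite ku kv ka kb //.
- by move=> *; apply: (fl u v).
- by move=> *; apply: (un v); rewrite // ?ka ?kb // gadget_sym.
- by move=> *; apply: (fl v u).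
- by move=> *; apply: (un v); rewrite // ?ka ?kb // gadget_sym.
- by move=> *; apply: (un u); rewrite // ?ka ?kb // gadget_sym.
- by move=> *; apply: (un u); rewrite // ?ka ?kb // gadget_sym.
Qed.

(** * Forbidden induced subgraphs of the reduced graph *)

Definition reduced : rel 'I_#|vtx| := fun a b => gadget (enum_val a) (enum_val b).

Lemma reduced_simple : simple_graph reduced.
Proof.
split=> [a|a b]; last exact: gadget_sym.
by apply/negP => /gadget_kind.
Qed.

(** The non-adjacent vertices 0 and 1 of the diamond would be two common neighbours of the edge
    between 2 and 3. *)
Lemma reduced_diamond_free : ~ induced_sub diamond reduced.
Proof.
case=> f [fI fE].
have adj (i j : nat) : i < 4 -> j < 4 -> diamond (inord i) (inord j) ->
    gadget (enum_val (f (inord i))) (enum_val (f (inord j))).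
  by move=> _ _; rewrite fE.
have d (i j : nat) : i < 4 -> j < 4 -> diamond (inord i) (inord j) =
    (i != j) && ~~ (((i == 0) && (j == 1)) || ((i == 1) && (j == 0))).
  by move=> i4 j4; rewrite /diamond -val_eqE /= !inordK.
have /enum_val_inj/fI : enum_val (f (inord 0)) = enum_val (f (inord 1)).
  by apply: (@common_neighbour_unique (enum_val (f (inord 2))) (enum_val (f (inord 3))));
     apply: adj; rewrite // d.
by move/(congr1 val); rewrite /= !inordK.
Qed.

(** An inner flag would have a vertex and an arc as its path neighbours, at distance two, whereas
    vertices and arcs are always adjacent. Hence positions 1 to 4 alternate between vertices and
    arcs, and positions 1 and 4 clash in the same way. The proof checks all assignments of kinds. *)
Lemma path6_kinds (k : nat -> kind) :
  ~~ [&& all (fun i => k i != k i.+1) (iota 0 5),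
         all (fun i => (k i.+1 == KFlag) ==> (k i != k i.+2)) (iota 0 4)
       & all (fun i => all (fun j => (i.+1 == j) || (j.+1 == i)
                || ~~ ((k i == KVertex) && (k j == KArc))) (iota 0 6)) (iota 0 6)].
Proof.
rewrite /=; case: (k 0) (k 1) (k 2) (k 3) (k 4) (k 5) => [[]|] [[]|] // [[]|] //.
all: by move=> [[]|] // [[]|] // [[]|].
Qed.

Lemma reduced_P6_free : ~ induced_sub (path_graph 6) reduced.
Proof.
case=> f [fI fE]; pose v (i : nat) := enum_val (f (inord i)).
have adj i j : i < 6 -> j < 6 -> gadget (v i) (v j) = (i.+1 == j) || (j.+1 == i).
  move=> i6 j6; have := fE (inord i) (inord j).
  by rewrite /path_graph /= !inordK // => ->.
have inj i j : i < 6 -> j < 6 -> v i = v j -> i = j.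
  move=> i6 j6 /enum_val_inj/fI/(congr1 val); by rewrite /= !inordK.
have step i : i < 5 -> kind_of (v i) <> kind_of (v i.+1).
  by move=> i5; apply: gadget_kind; rewrite adj ?eqxx //; lia.
have far i j : i < 6 -> j < 6 -> (i.+1 == j) || (j.+1 == i) = false ->
    kind_of (v i) = KVertex -> kind_of (v j) = KArc -> False.
  by move=> i6 j6 nij ki kj; have := gadget_vertex_arc ki kj; rewrite adj // nij.
have mid i : i < 4 -> kind_of (v i.+1) = KFlag -> kind_of (v i) <> kind_of (v i.+2).
  move=> i4 kz /(flag_neighbour_unique kz) H.
  have /(inj i i.+2 _ _) : v i = v i.+2 by apply: H; rewrite adj ?eqxx ?orbT //; lia.
  by lia.
have := path6_kinds (fun i => kind_of (v i)); case/negP; apply/and3P; split.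
- by apply/allP => i; rewrite mem_iota => /andP[_ i5]; apply/eqP/step.
- apply/allP => i; rewrite mem_iota => /andP[_ i4].
  by apply/implyP => /eqP kz; apply/eqP/mid.
- apply/allP => i; rewrite mem_iota => /andP[_ i6].
  apply/allP => j; rewrite mem_iota => /andP[_ j6].
  rewrite -implyNb; apply/implyP => /negbTE nij; apply/negP => /andP[/eqP ki /eqP kj].
  exact: far nij ki kj.
Qed.

End Gadget.

(** * Isomorphism of graphs and of their reduced graphs *)

Lemma card_vtx n : #|vtx n| = 3 * (n * n).
Proof. by rewrite !card_prod card_option card_bool card_ord mulnA. Qed.

Lemma isomorphic_reduced n m (E : rel 'I_n) (F : rel 'I_m) :
  isomorphic E F -> isomorphic (reduced E) (reduced F).
Proof.
move=> [f [[g fK gK] fE]].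
pose phi (u : vtx n) : vtx m := let: (b, i, j) := u in (b, f i, f j).
pose psi (u : vtx m) : vtx n := let: (b, i, j) := u in (b, g i, g j).
have phiK : cancel phi psi by move=> [[b i] j]; rewrite /= !fK.
have psiK : cancel psi phi by move=> [[b i] j]; rewrite /= !gK.
have fI := can_inj fK.
have phiE u v : gadget E u v = gadget F (phi u) (phi v).
  move: u v => [[[b|] i] j] [[[c|] k] l] //=; rewrite /incident ?fE ?(inj_eq fI) //.
  - by case: b; rewrite (inj_eq fI).
  - by case: c; rewrite (inj_eq fI).
exists (fun a => enum_rank (phi (enum_val a))); split.
  exists (fun a => enum_rank (psi (enum_val a))) => a; rewrite enum_rankK.
    by rewrite phiK enum_valK.
  by rewrite psiK enum_valK.
by move=> a b; rewrite /reduced phiE !enum_rankK.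
Qed.

(** An invariant description of the vertices, hence respected by isomorphisms. Every neighbour of an
    arc or of a flag has a second neighbour: a flag at an arc also sees an end, a vertex also sees
    its own pendant flags and, as [1 < n], some arc, and an arc sees all vertices. *)
Lemma pendant_vertexP n (E : rel 'I_n) (u : vtx n) : 1 < n ->
  (exists2 w, gadget E u w & forall t, gadget E t w -> t = u) <-> kind_of u = KVertex.
Proof.
move=> n1; split; last first.
  move: u => [[[b|] i] j] //=; case: eqP => // <- _; exists (Some true, i, i).
    by rewrite /= /incident !eqxx.
  by move=> [[[b|] k] l] //= /andP[_ /orP[] /andP[/eqP-> /eqP]] ->.
case=> w; move: u => [[[b|] i] j] /=; last first.
  case: eqP => // ij; move: w => [[[c|] k] l] /=.
    move=> inc /(_ (None, if c then k else l, if c then k else l)).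
    move: inc => /andP[act _] /=; rewrite /incident act !eqxx orbT => /(_ isT)[e1 e2].
    by case: ij; rewrite -e1.
  by case: (k =P l) => // -> _ /(_ (Some true, l, l)); rewrite /= /incident !eqxx => /(_ isT).
move: w => [[[c|] k] l] //= _ H.
have [kl|kl] := eqVneq k l; last first.
  by have := H (None, k, k); rewrite /= eqxx (negPf kl) => /(_ isT).
have [k' kk'] : exists k' : 'I_n, k' != k.
  have n0 : 0 < n by apply: ltnW.
  have [k0|k0] := eqVneq (nat_of_ord k) 0.
    by exists (Ordinal n1); rewrite -val_eqE /= k0.
  by exists (Ordinal n0); rewrite -val_eqE /= eq_sym.
by have := H (None, k', k); rewrite /= kl eqxx -kl (negPf kk') => /(_ isT).
Qed.

Definition base n (i : 'I_n) : vtx n := (None, i, i).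

(* The vertex [c] shared by the two triangles is an arc between [i] and [j]. *)
Lemma adjacent_trianglesP n (E : rel 'I_n) i j : simple_graph E -> i != j ->
  E i j <-> exists c a b, [/\ gadget E (base i) c, gadget E (base i) a, gadget E c a,
    gadget E (base j) c & gadget E (base j) b /\ gadget E c b].
Proof.
move=> [_ symE] ij; split=> [Eij|[c [a [b [ic ia ca jc [jb cb]]]]]].
  exists (None, i, j), (Some true, i, j), (Some false, i, j).
  by rewrite /= /incident Eij (negPf ij) !eqxx !orbT.
have kind_base x : kind_of (base x) = KVertex by rewrite /= eqxx.
have flag x a' : gadget E (base x) a' -> gadget E c a' -> kind_of c = KArc ->
    kind_of a' = KFlag.
  move=> /gadget_kind; rewrite kind_base => n1 /gadget_kind n2 kc.
  by case: (kind_of a') n1 n2 => // [[]] //; rewrite kc.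
(* A vertex cannot see the vertex [i], and a flag cannot see both [i] and [j]. *)
have kc : kind_of c = KArc.
  case ekc : (kind_of c) => [[]|] //; first by have := gadget_kind ic; rewrite ekc kind_base.
  have /(flag_neighbour_unique ekc) : gadget E c (base i) by rewrite gadget_sym.
  have cj : gadget E c (base j) by rewrite gadget_sym.
  by move=> /(_ _ cj); rewrite !kind_base => /(_ erefl)[e]; rewrite e eqxx in ij.
have := flag _ _ ia ca kc; have := flag _ _ jb cb kc; clear flag.
move: c a b kc ic ia ca jc jb cb => [[[?|] k] l] // [[[b1|] i1] j1] /=;
  last by move=> ?; do ?case: ifP.
move=> [[[b2|] i2] j2] /=; last by do ?case: ifP.
case: eqVneq => // kl _ _ ia ca _ jb cb _ _.
have [k1 l1] := incident_arc ca kl; have [k2 l2] := incident_arc cb kl.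
subst i1 j1 i2 j2; have Ekl : E k l by case/andP: ca; rewrite (negPf kl).
move: ij; rewrite (incidentE ia erefl) (incidentE jb erefl).
by case: (b1); case: (b2); rewrite ?eqxx // symE.
Qed.

(** The triangle criterion is existential, so it is carried along [phi]; used for an isomorphism and
    for its inverse, this yields the equivalence of adjacencies. *)
Lemma reduced_hom n (E F : rel 'I_n) (phi : vtx n -> vtx n) (g : 'I_n -> 'I_n) i j :
  simple_graph E -> simple_graph F ->
  (forall u v, gadget E u v = gadget F (phi u) (phi v)) ->
  phi (base i) = base (g i) -> phi (base j) = base (g j) ->
  i != j -> g i != g j -> E i j -> F (g i) (g j).
Proof.
move=> sE sF phiE gi gj ij gij /(adjacent_trianglesP sE ij)[c [a [b]]].
rewrite !phiE gi gj => H; apply/(adjacent_trianglesP sF gij).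
by exists (phi c), (phi a), (phi b).
Qed.

Lemma isomorphic_reduced_inv n m (E : rel 'I_n) (F : rel 'I_m) :
  simple_graph E -> simple_graph F ->
  isomorphic (reduced E) (reduced F) -> isomorphic E F.
Proof.
move=> sE sF iso.
have nm : n = m by have := isomorphic_size iso; rewrite !card_vtx; nia.
subst m; case: iso => f [[g fK gK] fE].
(* With at most one vertex both graphs are edgeless; otherwise [pendant_vertexP] is available. *)
have [n1|n1] := leqP n 1.
  exists id; split=> [|i j]; first by exists id.
  have -> : i = j by apply: val_inj; have := ltn_ord i; have := ltn_ord j; rewrite /=; lia.
  by rewrite (negPf (sE.1 j)) (negPf (sF.1 j)).
pose phi (u : vtx n) : vtx n := enum_val (f (enum_rank u)).
pose psi (u : vtx n) : vtx n := enum_val (g (enum_rank u)).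
have phiK : cancel phi psi by move=> u; rewrite /phi /psi enum_valK fK enum_rankK.
have psiK : cancel psi phi by move=> u; rewrite /phi /psi enum_valK gK enum_rankK.
have phiE u v : gadget E u v = gadget F (phi u) (phi v).
  by have := fE (enum_rank u) (enum_rank v); rewrite /reduced !enum_rankK.
have psiE u v : gadget F u v = gadget E (psi u) (psi v) by rewrite phiE !psiK.
have base_im E' F' (h k : vtx n -> vtx n) : cancel h k -> cancel k h ->
    (forall u v, gadget E' u v = gadget F' (h u) (h v)) ->
    forall i, h (base i) = base (h (base i)).2.
  move=> hK kK hE i.
  have : kind_of (h (base i)) = KVertex.
    have [_ /(_ _)[|w iw wP]] := pendant_vertexP E' (base i) n1; first by rewrite /= eqxx.
    apply/(pendant_vertexP F' _ n1); exists (h w); first by rewrite -hE.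
    by move=> t; rewrite -{1}[t]kK -hE => /wP <-; rewrite kK.
  by case: (h _) => [[[?|] k'] l] //=; case: eqP => // ->.
pose p i := (phi (base i)).2; pose q i := (psi (base i)).2.
have pE i : phi (base i) = base (p i) := base_im _ _ _ _ phiK psiK phiE i.
have qE i : psi (base i) = base (q i) := base_im _ _ _ _ psiK phiK psiE i.
have pK : cancel p q by move=> i; rewrite {1}/q -pE phiK.
have qK : cancel q p by move=> i; rewrite {1}/p -qE psiK.
exists p; split; first by exists q.
move=> i j; have [<-|ij] := eqVneq i j.
  by rewrite (negPf (sE.1 i)) (negPf (sF.1 _)).
have pij : p i != p j by rewrite (inj_eq (can_inj pK)).
apply/idP/idP; first exact: (reduced_hom sE sF phiE).
by move/(reduced_hom sF sE psiE (qE _) (qE _) pij); rewrite !pK; apply.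
Qed.

(** * Reasoning about loop programs *)

Section LoopReasoning.
Variables (K : nat) (w : seq sym).
Local Notation M := (max_index w).
Implicit Types (p q : prog K) (s : store K) (x y z : 'I_K) (V : seq 'I_K).

Lemma run_If t p q s : run w (If t p q) s = if teval w s t then run w p s else run w q s.
Proof. by []. Qed.

Lemma out_Seq p q s : (run w (Seq p q) s).2 = (run w p s).2 ++ (run w q (run w p s).1).2.
Proof. by []. Qed.

Definition agree (V : seq 'I_K) s s' := forall x, x \notin V -> s' x = s x.

(** The invariant is indexed by the number of completed iterations, since [x] saturates at [M] and
    cannot record the last one. *)
Lemma For_ind (P : nat -> store K -> seq sym -> Prop) x p s :
  x \notin writes p -> bounded w s -> P 0 (upd s x 0) [::] ->
  (forall i s' o, i <= M -> bounded w s' -> agree (x :: writes p) s s' -> s' x = i ->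
     P i s' o -> P i.+1 (inc w (run w p s').1 x) (o ++ (run w p s').2)) ->
  P M.+1 (run w (For x p) s).1 (run w (For x p) s).2.
Proof.
move=> xp bs P0 PS; rewrite run_For; set st0 := (_, _).
suff H i : i <= M.+1 -> let st := iter i (loop_body w p x) st0 in
    [/\ bounded w st.1, agree (x :: writes p) s st.1, (i <= M -> st.1 x = i) & P i st.1 st.2].
  by have [] := H M.+1 (leqnn _).
elim: i => [_|i IHi iM].
  split=> //=; first exact: bounded_upd.
    by move=> y; rewrite inE negb_or updE => /andP[/negPf-> _].
  by rewrite upd_same.
have [bst ag stx Pst] := IHi (ltnW iM); rewrite iterS; split.
- exact/bounded_inc/run_bounded.
- move=> y yp; rewrite -(ag y yp); move: yp; rewrite inE negb_or => /andP[/negPf yx yp].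
  by rewrite /= /inc updE yx run_frame.
- by move=> iM'; rewrite /= /inc upd_same run_frame // stx //; apply/minn_idPl.
- by apply: PS; rewrite ?stx.
Qed.

Lemma notin_writes V p x : all (mem V) (writes p) -> x \notin V -> x \notin writes p.
Proof. by move=> /allP pV; apply: contra; apply: pV. Qed.

Lemma out_For V (f : nat -> seq sym) x p s :
  all (mem V) (writes p) -> x \notin V -> bounded w s ->
  (forall i s', i <= M -> bounded w s' -> agree (x :: V) s s' -> s' x = i ->
     (run w p s').2 = f i) ->
  (run w (For x p) s).2 = flatten [seq f i | i <- iota 0 M.+1].
Proof.
move=> pV xV bs fP.
apply: (@For_ind (fun i _ o => o = flatten [seq f i | i <- iota 0 i]) x p s) => //.
  exact: notin_writes pV xV.
move=> i s' o iM bs' ag s'x ->; rewrite (fP i) //.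
  by rewrite -[in RHS]addn1 iotaD map_cat flatten_cat /= cats0.
move=> y; rewrite inE negb_or => /andP[yx yV]; apply: ag; rewrite inE negb_or yx.
exact: notin_writes pV yV.
Qed.

(** The rule for searching: the loop tries every value and only the sought one, [i0], produces
    output. *)
Lemma out_For_once V (r : seq sym) i0 x p s :
  all (mem V) (writes p) -> x \notin V -> bounded w s -> i0 <= M ->
  (forall i s', i <= M -> bounded w s' -> agree (x :: V) s s' -> s' x = i ->
     (run w p s').2 = if i == i0 then r else [::]) ->
  (run w (For x p) s).2 = r.
Proof.
move=> pV xV bs i0M rP; rewrite (out_For pV xV bs rP).
have nil a n : ~~ (a <= i0 < a + n) ->
    flatten [seq if i == i0 then r else [::] | i <- iota a n] = [::].
  elim: n a => [|n IHn] a //= nin; rewrite IHn ?cats0; last lia.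
  by rewrite ifN //; lia.
have -> : M.+1 = i0 + (1 + (M - i0)) by lia.
by rewrite !iotaD !map_cat !flatten_cat /= add0n eqxx !nil ?cats0 //; lia.
Qed.

Definition ForLt x y p := For x (If (TLt x y) p (Skip K)).

Lemma out_ForLt V n (f : 'I_n -> seq sym) x y p s :
  all (mem V) (writes p) -> x \notin V -> y \notin x :: V -> bounded w s -> s y = n ->
  (forall (i : 'I_n) s', bounded w s' -> agree (x :: V) s s' -> s' x = i ->
     (run w p s').2 = f i) ->
  (run w (ForLt x y p) s).2 = flatten [seq f i | i <- enum 'I_n].
Proof.
move=> pV xV yV bs sy fP.
have nM : n <= M.+1 by rewrite -sy ltnW // ltnS bs.
pose g i := if insub i is Some k then f k else [::].
have -> : (run w (ForLt x y p) s).2 = flatten [seq g i | i <- iota 0 M.+1].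
  apply: (@out_For V) => //; first by rewrite /= cats0.
  move=> i s' iM bs' ag s'x; rewrite run_If [teval _ _ _]/= s'x (ag y yV) sy /g.
  by case: insubP => [k -> ki|/negPf-> //]; apply: fP => //; rewrite s'x ki.
rewrite -[in LHS](subnKC nM) iotaD map_cat flatten_cat.
rewrite [X in _ ++ X](_ : _ = [::]) ?cats0.
  rewrite -val_enum_ord -map_comp; congr flatten; apply: eq_map => i.
  by rewrite /g /= valK.
suff nil m a : n <= a -> flatten [seq g i | i <- iota a m] = [::] by exact: nil.
elim: m a => //= m IHm a na.
by rewrite IHm ?(leqW na) // cats0 /g insubN // -leqNgt.
Qed.

Fixpoint silent p : bool :=
  match p with
  | Out _ => false
  | Seq p q | If _ p q => silent p && silent q
  | For _ p => silent p
  | _ => true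
  end.

Lemma out_silent p s : silent p -> (run w p s).2 = [::].
Proof.
elim: p s => [|x|x|a|p IHp q IHq|t p IHp q IHq|x p IHp] s //.
- by rewrite out_Seq => /andP[/IHp-> /IHq->].
- by rewrite run_If => /andP[sp sq]; case: ifP => _; [apply: IHp | apply: IHq].
- move=> sp; rewrite run_For.
  refine (iter_inv (P := fun so : store K * seq sym => so.2 = [::]) _ _ _) => // so so0.
  by rewrite /loop_body /= so0 IHp.
Qed.

Definition Add a x y := ForLt a y (Inc x).

Lemma run_Add a x y s : a != x -> a != y -> x != y -> bounded w s ->
  (run w (Add a x y) s).1 x = minn M (s x + s y).
Proof.
move=> ax ay xy bs.
have yM : s y <= M by apply: bs.
(* As [s y <= M], this is the invariant below at its final index [M.+1]. *)
have -> : s x + s y = s x + minn M.+1 (s y) by lia.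
apply: (@For_ind (fun i s' _ => s' x = minn M (s x + minn i (s y)))) => //=.
- by rewrite inE.
- by rewrite updE eq_sym (negPf ax); have := bs x; lia.
move=> i s' _ iM bs' ag s'a IH.
have -> : s' y = s y by apply: ag; rewrite !inE negb_or eq_sym ay eq_sym xy.
rewrite s'a; case: ltnP => iy /=; rewrite /inc !updE eq_sym (negPf ax) ?eqxx IH; lia.
Qed.

Definition AddMul a b x y z := ForLt b y (Add a x z).

Lemma run_AddMul a b x y z s : uniq [:: a; b; x] -> y \notin [:: a; b; x] ->
  z \notin [:: a; b; x] -> bounded w s ->
  (run w (AddMul a b x y z) s).1 x = minn M (s x + s y * s z).
Proof.
move=> abx yabx zabx bs; rewrite /= !inE !negb_or in abx yabx zabx.
case/and3P: abx => /andP[ab ax] bx _; case/and3P: yabx => ya yb yx; case/and3P: zabx => za zb zx.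
have yM : s y <= M by apply: bs.
have -> : s x + s y * s z = s x + minn M.+1 (s y) * s z by rewrite (minn_idPr (leqW yM)).
apply: (@For_ind (fun i s' _ => s' x = minn M (s x + minn i (s y) * s z))) => //.
- by rewrite /= !inE !negb_or eq_sym ab.
- by rewrite updE eq_sym (negPf bx) min0n; have := bs x; lia.
move=> i s' _ iM bs' ag s'b IH.
have s'y : s' y = s y by apply: ag; rewrite !inE !negb_or yb ya yx.
have s'z : s' z = s z by apply: ag; rewrite !inE !negb_or zb za zx.
rewrite /inc updE eq_sym (negPf bx) run_If [teval _ _ _]/= s'b s'y; case: ltnP => iy.
  rewrite run_Add // 1?eq_sym // IH s'z.
  have -> : minn i (s y) = i by lia.
  have -> : minn i.+1 (s y) = i.+1 by lia.
  by rewrite mulSn; lia.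
rewrite [run _ _ _]/= IH.
have -> : minn i (s y) = s y by lia.
by have -> : minn i.+1 (s y) = s y by lia.
Qed.

(** * Boolean expressions as nested tests *)

Inductive bexp :=
  | BTest of test K
  | BAnd of bexp & bexp
  | BOr of bexp & bexp
  | BXor of bexp & bexp.

Fixpoint beval s (b : bexp) : bool :=
  match b with
  | BTest t => teval w s t
  | BAnd b c => beval s b && beval s c
  | BOr b c => beval s b || beval s c
  | BXor b c => beval s b != beval s c
  end.

Fixpoint IfB (b : bexp) p q : prog K :=
  match b with
  | BTest t => If t p q
  | BAnd b c => IfB b (IfB c p q) q
  | BOr b c => IfB b p (IfB c p q)
  | BXor b c => IfB b (IfB c q p) (IfB c p q)
  end.

Lemma run_IfB b p q s : run w (IfB b p q) s = if beval s b then run w p s else run w q s.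
Proof.
elim: b p q => [t|b IHb c IHc|b IHb c IHc|b IHb c IHc] p q //=; rewrite IHb ?IHc;
  by case: (beval s b); case: (beval s c).
Qed.

Definition bit (b : bool) : sym := if b then S1 else S0.

Definition OutB (b : bexp) := IfB b (Out K S1) (Out K S0).

Lemma out_OutB b s : (run w (OutB b) s).2 = [:: bit (beval s b)].
Proof. by rewrite run_IfB; case: beval. Qed.

End LoopReasoning.

Arguments agree {K} V s s'.

(** * The program computing the reduction *)

(* [ve] is the position of the separator, [vt] the length of the input, [vn] the
   number of vertices, and [vp] a position in the input. *)
Definition ve : 'I_10 := @Ordinal 10 0 isT.
Definition vt : 'I_10 := @Ordinal 10 1 isT.
Definition vn : 'I_10 := @Ordinal 10 2 isT.
Definition vi : 'I_10 := @Ordinal 10 3 isT.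
Definition vj : 'I_10 := @Ordinal 10 4 isT.
Definition vk : 'I_10 := @Ordinal 10 5 isT.
Definition vl : 'I_10 := @Ordinal 10 6 isT.
Definition vp : 'I_10 := @Ordinal 10 7 isT.
Definition va : 'I_10 := @Ordinal 10 8 isT.
Definition vb : 'I_10 := @Ordinal 10 9 isT.

(* The matrix of the second graph starts right after the separator, at [ve]. *)
Definition add_offset (second : bool) : prog 10 :=
  if second then For va (If (TLt ve va) (Skip 10) (Inc vp)) else Skip 10.

(* [vp] receives the position of the entry [(x, y)]. *)
Definition locate (second : bool) (x y : 'I_10) : prog 10 :=
  Seq (Zero vp) (Seq (add_offset second) (Seq (AddMul va vb vp x vn) (Add va vp y))).

(** Presupposes that [locate] has put the position of the matrix entry [(i, j)] into [vp]; the
    symbol [S1] there stands for an edge. *)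
Definition incident_exp (b : bool) (i j k l : 'I_10) : bexp 10 :=
  BAnd (BOr (BTest (TEq i j)) (BTest (TSym vp (sym_index S1))))
       (BOr (BAnd (BTest (TEq k i)) (BTest (TEq l j)))
            (BAnd (BTest (TEq k l)) (BTest (TEq k (if b then i else j))))).

Definition entry_prog (second : bool) (a c : option bool) : prog 10 :=
  match a, c with
  | None, None => OutB (BXor (BTest (TEq vi vj)) (BTest (TEq vk vl)))
  | Some b, None => Seq (locate second vi vj) (OutB (incident_exp b vi vj vk vl))
  | None, Some b => Seq (locate second vk vl) (OutB (incident_exp b vk vl vi vj))
  | Some _, Some _ => Out 10 S0
  end.

Definition each_tag (f : option bool -> prog 10) : prog 10 :=
  Seq (f None) (Seq (f (Some true)) (f (Some false))).

Definition row_prog (second : bool) (a : option bool) : prog 10 :=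
  each_tag (fun c => ForLt vk vn (ForLt vl vn (entry_prog second a c))).

Definition matrix_prog (second : bool) : prog 10 :=
  each_tag (fun a => ForLt vi vn (ForLt vj vn (row_prog second a))).

(** The number of vertices is found by trial: the right [vn] is the one for which the matrix, of
    [vn * vn] entries, ends at position [lim]. *)
Definition graph_prog (second : bool) (lim : 'I_10) : prog 10 :=
  For vn (Seq (Zero vp) (Seq (add_offset second) (Seq (AddMul va vb vp vn vn)
    (If (TEq vp lim) (matrix_prog second) (Skip 10))))).

(** The separator and the end of the input are found by search; the first matrix ends at [ve], the
    second at [vt]. *)
Definition main_prog : prog 10 :=
  For ve (If (TSym ve (sym_index Sep))
    (For vt (If (TSym vt end1)
       (Seq (graph_prog false ve) (Seq (Out 10 Sep) (graph_prog true vt)))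
       (Skip 10)))
    (Skip 10)).

Lemma wf_main_prog : wf main_prog.
Proof. by vm_compute. Qed.

(** * The order in which the entries of the reduced matrix are listed *)

Lemma flatten_map_allpairs (A B R : Type) (h : A * B -> seq R) (s : seq A) (t : seq B) :
  flatten [seq h x | x <- [seq (a, b) | a <- s, b <- t]]
  = flatten [seq flatten [seq h (a, b) | b <- t] | a <- s].
Proof. by elim: s => //= a s IHs; rewrite map_cat flatten_cat IHs -map_comp. Qed.

(** The enumeration of the product type is that of nested loops with the tag outermost, which is the
    loop order of the program. *)
Lemma flatten_enum_vtx n (h : vtx n -> seq sym) :
  flatten [seq h u | u <- enum {: vtx n}]
  = flatten [seq flatten [seq flatten [seq h (a, i, j) | j <- enum 'I_n] | i <- enum 'I_n]
            | a <- [:: None; Some true; Some false]].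
Proof.
have enum2 (A B : finType) : enum {: A * B} = [seq (a, b) | a <- enum A, b <- enum B].
  by rewrite [LHS]enumT unlock.
have enumO : enum {: option bool} = [:: None; Some true; Some false].
  by rewrite enumT unlock /= /option_enum unlock.
by rewrite enum2 flatten_map_allpairs enum2 flatten_map_allpairs enumO.
Qed.

Lemma map_enum_val (T : finType) : [seq enum_val a | a <- enum 'I_#|T|] = enum T.
Proof.
have sz : size [seq enum_val a | a <- enum 'I_#|T|] = #|T| by rewrite size_map size_enum_ord.
case: (pickP T) => [x _|T0].
  apply: (@eq_from_nth _ x); rewrite sz -?cardE // => i iT.
  rewrite (nth_map (Ordinal iT)) ?size_enum_ord // (enum_val_nth x).
  by rewrite nth_enum_ord.
have c0 : #|T| = 0 by apply: eq_card0.
by rewrite [LHS]size0nil ?sz // [RHS]size0nil // -cardE.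
Qed.

Lemma code_reduced n (E : rel 'I_n) : code (reduced E) =
  flatten [seq flatten [seq [:: bit (gadget E u v)] | v <- enum {: vtx n}]
          | u <- enum {: vtx n}].
Proof.
rewrite -map_enum_val -map_comp; congr flatten; apply: eq_map => a /=.
by rewrite -map_comp; elim: (enum _) => //= b s ->.
Qed.

(** * Correctness of the program printing one reduced matrix *)

Section MatrixProgram.
Variables (w : seq sym) (n o e : nat) (E : rel 'I_n) (second : bool).
Local Notation M := (max_index w).
Hypothesis oE : o = if second then e.+1 else 0.
Hypothesis eM : e < M.
Hypothesis onM : o + n * n <= M.
Hypothesis symE : forall i j : 'I_n,
  sym_at w (o + i * n + j) = sym_index (if E i j then S1 else S0).

(** For the second graph [vp] is incremented while [va] runs through [0, ..., e], that is, [e + 1]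
    times. *)
Lemma run_add_offset s : bounded w s -> s ve = e -> s vp = 0 ->
  (run w (add_offset second) s).1 vp = o.
Proof.
rewrite oE /add_offset; case: second => // bs se sp.
have -> : e.+1 = minn M.+1 e.+1 by lia.
apply: (@For_ind _ w (fun i s' _ => s' vp = minn i e.+1)) => //.
  by rewrite updE sp min0n.
move=> i s' _ iM bs' ag s'a IH.
have s'e : s' ve = e by rewrite ag.
rewrite /inc updE run_If [teval _ _ _]/= s'e s'a; case: ltnP => ie /=.
  by rewrite IH; lia.
by rewrite /inc updE /= IH; lia.
Qed.

Lemma run_locate x y (s : store 10) (i j : 'I_n) :
  x \notin [:: va; vb; vp] -> y \notin [:: va; vb; vp] ->
  bounded w s -> s ve = e -> s vn = n -> s x = i -> s y = j ->
  (run w (locate second x y) s).1 vp = o + i * n + j.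
Proof.
move=> xabp yabp bs se sn sx sy.
(* The position thus lies inside the matrix, and no addition saturates. *)
have ij : i * n + j < n * n by have := ltn_ord i; have := ltn_ord j; nia.
set s1 := upd s vp 0; have b1 : bounded w s1 by apply: bounded_upd.
set s2 := (run w (add_offset second) s1).1; have b2 : bounded w s2 by apply: run_bounded.
set s3 := (run w (AddMul va vb vp x vn) s2).1; have b3 : bounded w s3 by apply: run_bounded.
have w2 z : z \notin [:: va; vb; vp] -> s2 z = s z.
  move=> zabp; rewrite /s2 run_frame.
    by rewrite /s1 updE; move: zabp; rewrite !inE !negb_or => /and3P[_ _ /negPf->].
  by rewrite /add_offset; case: second => //; move: zabp; rewrite !inE !negb_or => /and3P[-> _ ->].
have w3 z : z \notin [:: va; vb; vp] -> s3 z = s z.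
  move=> zabp; rewrite /s3 run_frame ?w2 //.
  by move: zabp; rewrite !inE !negb_or => /and3P[-> -> ->].
have s2p : s2 vp = o by apply: run_add_offset; rewrite // /s1 updE ?eqxx.
have s3p : s3 vp = o + i * n.
  by rewrite /s3 run_AddMul // s2p !w2 // sx sn; apply/minn_idPr; lia.
change ((run w (Add va vp y) s3).1 vp = o + i * n + j).
rewrite run_Add // ?s3p ?w3 // ?sy.
- by apply/minn_idPr; lia.
- by move: yabp; rewrite !inE !negb_or eq_sym => /and3P[].
- by move: yabp; rewrite !inE !negb_or => /and3P[_ _]; rewrite eq_sym.
Qed.

Lemma eval_incident b x y x' y' (s : store 10) (i j k l : 'I_n) :
  s x = i -> s y = j -> s x' = k -> s y' = l -> s vp = o + i * n + j ->
  beval w s (incident_exp b x y x' y') = incident E b i j k l.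
Proof.
move=> sx sy sx' sy' sp; rewrite /= (fun_if s) sx sy sx' sy' sp symE.
have -> : (sym_index (if E i j then S1 else S0) == sym_index S1) = E i j.
  by case: (E i j); rewrite /= -val_eqE /= !inordK.
by rewrite /incident -!val_eqE (fun_if val).
Qed.

Lemma out_entry a c (s : store 10) (i j k l : 'I_n) : bounded w s -> s ve = e -> s vn = n ->
  s vi = i -> s vj = j -> s vk = k -> s vl = l ->
  (run w (entry_prog second a c) s).2 = [:: bit (gadget E (a, i, j) (c, k, l))].
Proof.
move=> bs se sn si sj sk sl.
have fr x y z : z \notin [:: va; vb; vp] -> (run w (locate second x y) s).1 z = s z.
  move=> zabp; apply: run_frame; apply: notin_writes zabp.
  by rewrite /locate /add_offset; case: second.
have nil x y : (run w (locate second x y) s).2 = [::].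
  by apply: out_silent; rewrite /locate /add_offset; case: second.
case: a c => [b|] [c|] //.
- rewrite out_Seq nil out_OutB (@eval_incident _ _ _ _ _ _ i j k l) //;
    first [exact: run_locate | by rewrite fr].
- rewrite out_Seq nil out_OutB (@eval_incident _ _ _ _ _ _ k l i j) //;
    first [exact: run_locate | by rewrite fr].
- by rewrite out_OutB /= si sj sk sl.
Qed.

Lemma out_each_tag V (f : option bool -> prog 10) (g : option bool -> seq sym) s :
  (forall a, all (mem V) (writes (f a))) -> bounded w s ->
  (forall a s', bounded w s' -> agree V s s' -> (run w (f a) s').2 = g a) ->
  (run w (each_tag f) s).2 = flatten [seq g a | a <- [:: None; Some true; Some false]].
Proof.
move=> fV bs fP.
have fr a s' : agree V s s' -> agree V s (run w (f a) s').1.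
  by move=> ag x xV; rewrite run_frame ?ag //; apply: notin_writes (fV a) xV.
rewrite /each_tag !out_Seq [RHS]/= cats0.
have ag0 : agree V s s by [].
rewrite !fP //.
- exact/run_bounded/run_bounded.
- exact/fr/fr.
- exact: run_bounded.
- exact: fr.
Qed.

Lemma writes_entry a c : all (mem [:: vp; va; vb]) (writes (entry_prog second a c)).
Proof. by case: second a c => [] [[]|] [[]|]. Qed.

Lemma writes_row a : all (mem [:: vk; vl; vp; va; vb]) (writes (row_prog second a)).
Proof. by case: second a => [] [[]|]. Qed.

Lemma out_row a (s : store 10) (i j : 'I_n) : bounded w s -> s ve = e -> s vn = n ->
  s vi = i -> s vj = j ->
  (run w (row_prog second a) s).2
  = flatten [seq [:: bit (gadget E (a, i, j) v)] | v <- enum {: vtx n}].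
Proof.
move=> bs se sn si sj; rewrite flatten_enum_vtx.
apply: (@out_each_tag [:: vk; vl; vp; va; vb]) => //.
  by move=> c; case: second a c => [] [[]|] [[]|].
move=> c s1 b1 ag1.
apply: (@out_ForLt _ _ [:: vl; vp; va; vb]) => //; last 2 first.
- by rewrite ag1.
- move=> k s2 b2 ag2 s2k.
  apply: (@out_ForLt _ _ [:: vp; va; vb]) => //; last 2 first.
  + by rewrite ag2 // ag1.
  + move=> l s3 b3 ag3 s3l; apply: out_entry => //.
    * by rewrite ag3 // ag2 // ag1.
    * by rewrite ag3 // ag2 // ag1.
    * by rewrite ag3 // ag2 // ag1.
    * by rewrite ag3 // ag2 // ag1.
    * by rewrite ag3.
  + exact: writes_entry.
- by case: second a c => [] [[]|] [[]|].
Qed.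

Lemma out_matrix s : bounded w s -> s ve = e -> s vn = n ->
  (run w (matrix_prog second) s).2 = code (reduced E).
Proof.
move=> bs se sn; rewrite code_reduced flatten_enum_vtx.
apply: (@out_each_tag [:: vi; vj; vk; vl; vp; va; vb]) => //.
  by move=> c; case: second c => [] [[]|].
move=> a s1 b1 ag1.
apply: (@out_ForLt _ _ [:: vj; vk; vl; vp; va; vb]) => //; last 2 first.
- by rewrite ag1.
- move=> i s2 b2 ag2 s2i.
  apply: (@out_ForLt _ _ [:: vk; vl; vp; va; vb]) => //; last 2 first.
  + by rewrite ag2 // ag1.
  + move=> j s3 b3 ag3 s3j; apply: out_row => //.
    * by rewrite ag3 // ag2 // ag1.
    * by rewrite ag3 // ag2 // ag1.
    * by rewrite ag3.
  + exact: writes_row.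
- by case: second a => [] [[]|].
Qed.

Lemma out_graph lim s : lim \in [:: ve; vt] -> bounded w s -> s ve = e -> s lim = o + n * n ->
  o + n * n < M -> (run w (graph_prog second lim) s).2 = code (reduced E).
Proof.
move=> limv bs se sl onM'.
have limV : lim \notin [:: vi; vj; vk; vl; vp; va; vb].
  by move: limv; rewrite !inE => /orP[] /eqP->.
apply: (@out_For_once _ _ [:: vi; vj; vk; vl; vp; va; vb] _ n) => //.
- by case: second limv => []; rewrite !inE => /orP[] /eqP->.
- by nia.
move=> c s1 cM b1 ag1 s1n.
rewrite !out_Seq; set s2 := (run w (Zero vp) s1).1; set s3 := (run w (add_offset second) s2).1.
set s4 := (run w (AddMul va vb vp vn vn) s3).1.
have b2 : bounded w s2 by apply: run_bounded.
have b3 : bounded w s3 by apply: run_bounded.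
have b4 : bounded w s4 by apply: run_bounded.
have fr2 x : x \notin [:: vp; va; vb] -> s2 x = s1 x.
  by move=> xV; apply: run_frame; apply: notin_writes xV.
have fr3 x : x \notin [:: vp; va; vb] -> s3 x = s1 x.
  move=> xV; rewrite -fr2 //; apply: run_frame; apply: notin_writes xV.
  by case: second.
have fr4 x : x \notin [:: vp; va; vb] -> s4 x = s1 x.
  by move=> xV; rewrite -fr3 //; apply: run_frame; apply: notin_writes xV.
have s1e : s1 ve = e by rewrite ag1.
have s1l : s1 lim = o + n * n.
  by rewrite ag1 // inE negb_or limV andbT; move: limv; rewrite !inE => /orP[] /eqP->.
have s4l : s4 lim = o + n * n.
  by rewrite fr4 //; move: limv; rewrite !inE => /orP[] /eqP->.
have s2p : s2 vp = 0 by rewrite /s2 /= upd_same.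
have s3p : s3 vp = o by apply: run_add_offset => //; rewrite fr2.
have s4p : s4 vp = minn M (o + c * c).
  by rewrite /s4 run_AddMul // s3p fr3 // s1n.
have -> : (run w (Zero vp) s1).2 = [::] by [].
have -> : (run w (add_offset second) s2).2 = [::] by apply: out_silent; case: second.
have -> : (run w (AddMul va vb vp vn vn) s3).2 = [::] by apply: out_silent.
rewrite run_If [teval _ _ _]/= s4p s4l.
(* A saturated [vp] equals [M], which is strictly above [o + n * n]; hence only [c = n] passes the
   test. *)
have -> : (minn M (o + c * c) == o + n * n) = (c == n).
  have [->|cn] := eqVneq c n; first by rewrite (minn_idPr onM) eqxx.
  by apply/eqP => H; have cc : c * c = n * n by [lia]; nia.
case: eqP => // cn; rewrite !cat0s out_matrix //.
- by rewrite fr4.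
- by rewrite fr4 // s1n.
Qed.

End MatrixProgram.

(** * Encodings and reductions *)

Lemma size_flatten_const (T : Type) n (ss : seq (seq T)) :
  all (fun r => size r == n) ss -> size (flatten ss) = size ss * n.
Proof. by elim: ss => //= r ss IHss /andP[/eqP rn /IHss]; rewrite size_cat rn mulSn => ->. Qed.

Lemma nth_flatten_const (T : Type) (x : T) n (ss : seq (seq T)) i j :
  all (fun r => size r == n) ss -> j < n ->
  nth x (flatten ss) (i * n + j) = nth x (nth [::] ss i) j.
Proof.
elim: ss i => [|r ss IHss] [|i] //=; rewrite ?nth_nil // => /andP[/eqP rn ssn] jn.
  by rewrite mul0n add0n nth_cat rn jn.
by rewrite nth_cat rn mulSn -addnA ltnNge leq_addr addKn IHss.
Qed.

Section Code.
Variables (n : nat) (E : rel 'I_n).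

Lemma code_rows : all (fun r : seq sym => size r == n)
  [seq [seq (if E i j then S1 else S0) | j <- enum 'I_n] | i <- enum 'I_n].
Proof. by rewrite all_map; apply/allP => i _; rewrite /= size_map size_enum_ord. Qed.

Lemma size_code : size (code E) = n * n.
Proof. by rewrite (size_flatten_const code_rows) size_map size_enum_ord. Qed.

Lemma nth_code (i j : 'I_n) : nth S0 (code E) (i * n + j) = if E i j then S1 else S0.
Proof.
rewrite (nth_flatten_const S0 _ code_rows) // (nth_map i) ?size_enum_ord //.
by rewrite (nth_map j) ?size_enum_ord // !nth_ord_enum.
Qed.

Definition is_sep (a : sym) : bool := if a is Sep then true else false.

Lemma code_no_sep : all (predC is_sep) (code E).
Proof.
rewrite /code; elim: (X in map _ X) => // i r IHr.
by rewrite /= all_cat IHr andbT; elim: (enum _) => //= j u ->; case: (E i j).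
Qed.

End Code.

Lemma code_isomorphic n m (E : rel 'I_n) (F : rel 'I_m) : code E = code F -> isomorphic E F.
Proof.
move=> EF; have nm : n = m by have := congr1 size EF; rewrite !size_code; nia.
subst m; exists id; split=> [|i j]; first by exists id.
by have := nth_code F i j; rewrite -EF nth_code; case: (E i j); case: (F i j).
Qed.

Lemma cat_sep_inj (a a' u u' : seq sym) : all (predC is_sep) a -> all (predC is_sep) a' ->
  a ++ Sep :: u = a' ++ Sep :: u' -> a = a' /\ u = u'.
Proof.
elim: a a' => [|x a IHa] [|x' a'] //=.
- by move=> _ _ [].
- by move=> _ /andP[nx' _] [ex]; rewrite -ex in nx'.
- by move=> /andP[nx _] _ [ex]; rewrite ex in nx.
- by move=> /andP[_ na] /andP[_ na'] [-> /(IHa _ na na')[-> ->]].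
Qed.

(** The yes-instances quantify over all graphs encoded by a word; by this lemma the answer does not
    depend on the decoding. *)
Lemma code_pair_isomorphic n m n' m' (E : rel 'I_n) (F : rel 'I_m) (E' : rel 'I_n')
    (F' : rel 'I_m') :
  code E ++ Sep :: code F = code E' ++ Sep :: code F' -> isomorphic E F -> isomorphic E' F'.
Proof.
case/cat_sep_inj; do ?exact: code_no_sep.
move=> /code_isomorphic EE' /code_isomorphic FF' EF.
exact: isomorphic_trans (isomorphic_sym EE') (isomorphic_trans EF FF').
Qed.

Lemma sym_atE (w : seq sym) i : i < size w -> sym_at w i = sym_index (nth S0 w i).
Proof. by move=> iw; rewrite /sym_at nth_rcons size_map iw (nth_map S0). Qed.

Lemma sym_at_end1 (w : seq sym) i : i <= max_index w -> (sym_at w i == end1) = (i == size w).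
Proof.
move=> iM; case: ltngtP => [iw|iw|->].
- by rewrite sym_atE // /sym_index /end1; case: nth; rewrite inord5_eq.
- by rewrite /sym_at nth_default ?size_rcons ?size_map // /end2 /end1 inord5_eq.
- by rewrite /sym_at nth_rcons size_map ltnn eqxx eqxx.
Qed.

Lemma sym_at_sep (a u : seq sym) i : all (predC is_sep) a -> all (predC is_sep) u ->
  (sym_at (a ++ Sep :: u) i == sym_index Sep) = (i == size a).
Proof.
move=> na nu; set w := _ ++ _.
have isS x : (sym_index x == sym_index Sep) = is_sep x.
  by case: x; rewrite /sym_index inord5_eq.
have nth_no_sep v k : all (predC is_sep) v -> is_sep (nth S0 v k) = false.
  by elim: v k => [|x v IHv] [|k] //= /andP[/negPf nx /IHv].
have [iw|iw] := ltnP i (size w).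
  rewrite sym_atE // isS /w nth_cat; case: ltngtP => [ia|ia|->].
  - exact: nth_no_sep.
  - by rewrite -[i - _]prednK ?subn_gt0 // [nth _ _ _]/= nth_no_sep.
  - by rewrite subnn.
have -> : (i == size a) = false by move: iw; rewrite /w size_cat /=; lia.
rewrite /sym_at nth_rcons size_map ltnNge iw /=.
by case: ifP => _; rewrite /end1 /end2 /sym_index inord5_eq.
Qed.

Lemma transduce_main n m (E : rel 'I_n) (F : rel 'I_m) :
  transduce main_prog (code E ++ Sep :: code F)
  = code (reduced E) ++ Sep :: code (reduced F).
Proof.
set w := code E ++ Sep :: code F.
have sw : size w = (n * n + m * m).+1 by rewrite size_cat /= !size_code addnS.
have MwE : max_index w = (size w).+1 by [].
have b0 : bounded w (zero_store 10) by move=> x; rewrite ffunE.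
apply: (@out_For_once _ _ [:: vt; vn; vi; vj; vk; vl; vp; va; vb] _ (n * n)) => //.
  by rewrite MwE sw; lia.
move=> e s1 eM b1 _ s1e.
rewrite run_If [teval _ _ _]/= s1e sym_at_sep ?code_no_sep // size_code.
case: eqP => // en; subst e.
apply: (@out_For_once _ _ [:: vn; vi; vj; vk; vl; vp; va; vb] _ (size w)) => //.
move=> t s2 tM b2 ag2 s2t.
rewrite run_If [teval _ _ _]/= s2t sym_at_end1 //.
case: eqP => // tw; subst t; rewrite !out_Seq.
have s2e : s2 ve = n * n by rewrite ag2.
congr (_ ++ _ :: _).
  apply: (@out_graph w n 0 (n * n)) => //; rewrite ?MwE ?sw; try lia.
  move=> i j; have ij : i * n + j < n * n.
    by have := ltn_ord i; have := ltn_ord j; nia.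
  rewrite add0n sym_atE; last by rewrite sw; lia.
  by rewrite nth_cat size_code ij nth_code.
set s3 := (run w (Out 10 Sep) _).1.
have fr x : x \notin [:: vn; vi; vj; vk; vl; vp; va; vb] -> s3 x = s2 x.
  by move=> xV; rewrite /s3 !run_frame //; apply: notin_writes xV.
have b3 : bounded w s3 by do 2!apply: run_bounded.
(* The second matrix starts right behind the separator and ends at the length of the input, the
   value of [vt]. *)
apply: (@out_graph w m (n * n).+1 (n * n)) => //; rewrite ?MwE ?fr // ?s2t ?sw; try lia.
move=> i j; have ij : i * m + j < m * m.
  by have := ltn_ord i; have := ltn_ord j; nia.
rewrite sym_atE; last by rewrite sw; lia.
have -> : (n * n).+1 + i * m + j = n * n + (i * m + j).+1 by lia.
by rewrite nth_cat size_code ltnNge leq_addr addKn /= nth_code.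
Qed.

(** * The two reductions *)

Lemma poly_time_id : poly_time id.
Proof.
(* The machine is halted in its initial state, so the tape still shows the input. *)
exists (@mkTM 0 0 (fun q a => (q, a, Stay)) (fun=> true)), 0 => w; exists 0; split=> //.
split=> //=; elim: w => //= a w ->.
by rewrite code_sym_sym_code.
Qed.

(** The identity is a reduction: a restricted instance is an instance of [GI], and the free graphs
    given by the domain decode the same word as any isomorphic pair for it. *)
Lemma restricted_reduces_to_GI : poly_reduces GI_diamond_P6 GI.
Proof.
exists id; split=> [|w]; first exact: poly_time_id.
move=> [n [m [E [F [sE [sF [fE [fF wE]]]]]]]]; split; first by exists n, m, E, F.
split=> [[n' [m' [E' [F' [sE' [sF' [_ [_ [wE' iso]]]]]]]]]|]; first by exists n', m', E', F'.
move=> [n' [m' [E' [F' [_ [_ [wE' iso]]]]]]].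
exists n, m, E, F; do 4!split=> //; split=> //.
by apply: code_pair_isomorphic iso; rewrite -wE' -wE.
Qed.

Lemma reduced_free n (E : rel 'I_n) : diamond_P6_free (reduced E).
Proof. by split; [exact: reduced_diamond_free | exact: reduced_P6_free]. Qed.

Lemma GI_reduces_to_restricted : poly_reduces GI GI_diamond_P6.
Proof.
exists (transduce main_prog); split=> [|w]; first exact/poly_time_transduce/wf_main_prog.
move=> [n [m [E [F [sE [sF wE]]]]]]; subst w; rewrite transduce_main.
have rE := reduced_simple E; have fE := reduced_free E.
have rF := reduced_simple F; have fF := reduced_free F.
split; first by exists _, _, (reduced E), (reduced F).
split=> [[n' [m' [E' [F' [_ [_ [wE' iso]]]]]]]|].
  exists _, _, (reduced E), (reduced F).
  do 5!split=> //.
  by apply/isomorphic_reduced/(code_pair_isomorphic _ iso).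
move=> [n' [m' [E' [F' [_ [_ [_ [_ [wE' iso]]]]]]]]].
exists n, m, E, F; do 3!split=> //.
apply: isomorphic_reduced_inv => //.
by apply: code_pair_isomorphic iso; rewrite wE'.
Qed.

Theorem theorem6 : GI_complete GI_diamond_P6.
Proof. by split; [exact: restricted_reduces_to_GI | exact: GI_reduces_to_restricted]. Qed.
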